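(* Let $\psi$ be a topological quantum-graph state, with eigenvalue $k^2$, on a finite connected quantum graph with $n$ vertices and $m$ edges, and let $x \in \mathbb{C}^{4m}$ be its counterpart edge-space vector, with components $x_1,x_2\in\mathbb C^{2m}$ (all as defined in the context). Then: (A) For $\ell = 1,2$, $\ \delta_t^* x_\ell = 0$. (B) On every oriented edge, $x_1({\bf e}) = 0$. Consequently, $\psi$ satisfies Dirichlet conditions ($\psi(v)=0$) at every vertex (this statement excludes ''fake vertices'' of degree 2). In particular, topological quantum-graph states vanish identically on leaves, i.e. on edges having a terminal vertex of degree one. (C) There are at most $\beta_1 = m-n+1$ linearly independent topological quantum-graph states for a given eigenvalue, and they have an eigenbasis consisting of states supported on generating cycles $\mathcal{C}_j$ of the fundamental group of the underlying combinatorial graph. For any topological quantum-graph state in such a basis, supported on $\mathcal C_j$, the Dirichlet problems for the edges ${\bf e} \subset \mathcal{C}_j$ on which it is supported must share the eigenvalue $k^2$.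
   Context: Combinatorial setting. Each of the $m$ edges gives two oriented edges, ${\bf e}$ and its reversal $-{\bf e}$; ${\bf e}$ has source vertex $s({\bf e})$ and terminal vertex $t({\bf e})$. $d_v$ is the degree of the vertex $v$. $\delta_t^*$ is the $n\times 2m$ matrix with $(\delta_t^* )_{t({\bf e}),{\bf e}}=1$ and all other entries $0$. $\tau$ is the $2m\times2m$ permutation matrix of ${\bf e}\mapsto-{\bf e}$. The bond-scattering matrix $\mathcal S$ is the $2m\times 2m$ matrix with $\mathcal S_{{\bf e}'{\bf e}}=0$ unless $t({\bf e})=s({\bf e}')$; if $t({\bf e})=s({\bf e}')$ and ${\bf e}'\neq-{\bf e}$, then $\mathcal S_{{\bf e}'{\bf e}}=2/d_{t({\bf e})}$; and $\mathcal S_{-{\bf e}\,{\bf e}}=2/d_{t({\bf e})}-1$. Put $\hat{\mathcal S}=\mathcal S\otimes\mathbb 1_2$ and $\hat\tau=\tau\otimes\mathbb 1_2$, acting on $\mathbb C^{4m}$, whose elements are regarded as families of 2-vectors $x({\bf e})=(x_1({\bf e}),x_2({\bf e}))$ attached to the oriented edges. Quantum graph. Edge ${\bf e}$ is identified with an interval of length $\ell_{\bf e}=\ell_{-{\bf e}}>0$, parametrized from $s({\bf e})$ to $t({\bf e})$, and carries a real-valued potential $V$ (integrable on each edge). A quantum-graph eigenfunction with eigenvalue $k^2$ is a nonzero continuous function $\psi$ on the metric graph with $-\psi''+V\psi=k^2\psi$ on the edges and Kirchhoff vertex conditions: continuity at vertices, and the sum of the outgoing derivatives is $0$ at each vertex.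 The transfer matrix $\Phi_{\bf e}(k)$ is the $2\times2$ invertible matrix mapping $(\psi,\psi')$ at $s({\bf e})$ to $(\psi,\psi')$ at $t({\bf e})$, the derivative being taken along the orientation of ${\bf e}$, for solutions of the equation. It satisfies $\Phi_{-{\bf e}}=\sigma\Phi_{\bf e}^{-1}\sigma$ with $\sigma=\operatorname{diag}(1,-1)$, and is an entire function of $k$. $\Phi(k)$ is the $4m\times 4m$ block-diagonal matrix with blocks $\Phi_{\bf e}(k)$. The counterpart of an eigenfunction $\psi$ is the vector $x\in\mathbb C^{4m}$ with $x_1({\bf e})=\psi(s({\bf e}))$ and $x_2({\bf e})=\psi'(s({\bf e}))$ (outgoing derivative along ${\bf e}$) for each oriented edge ${\bf e}$. A topological quantum-graph state is a quantum-graph eigenfunction $\psi$ whose counterpart $x$ simultaneously satisfies $(\hat{\mathcal S}+\hat\tau)x=0$ and $(\mathbb 1-\Phi(k)\hat{\mathcal S})x=0$. The Dirichlet problem on an edge is $-u''+Vu=k^2u$ with $u=0$ at both ends. *)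

(* Defs.v *)
From HB Require Import structures.
From mathcomp Require Import all_boot all_order all_algebra.
From mathcomp Require Import all_classical all_reals all_analysis.
From mathcomp.real_closed Require Import complex mxtens.

Set Implicit Arguments.
Unset Strict Implicit.
Unset Printing Implicit Defensive.

Import Order.TTheory GRing.Theory Num.Theory.
Import numFieldNormedType.Exports.

Local Open Scope classical_set_scope.
Local Open Scope ring_scope.
Local Open Scope complex_scope.

(* Multigraphs; loops and parallel edges are allowed.  The choice of [tail] and
   [head] is only a reference orientation.  Oriented edges are ['I_(m + m)]:
   [lshift m e] is [e] in its reference orientation, [rshift m e] is [- e]. *)
Record mgraph (n m : nat) := MGraph {
  tail : 'I_m -> 'I_n;
  head : 'I_m -> 'I_n
}.

Section OrientedEdges.
Variables n m : nat.
Implicit Types (G : mgraph n m) (d : 'I_(m + m)).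

Definition forward d : bool := if fintype.split d is inl _ then true else false.

Definition edge_of d : 'I_m := match fintype.split d with inl e => e | inr e => e end.

Definition bar d : 'I_(m + m) :=
  match fintype.split d with inl e => rshift m e | inr e => lshift m e end.

Definition src G d : 'I_n :=
  if forward d then tail G (edge_of d) else head G (edge_of d).

Definition tgt G d : 'I_n := src G (bar d).

(* A loop contributes 2 to the degree. *)
Definition degree G (v : 'I_n) : nat := #|[set d | src G d == v]%SET|.

Definition adjacent G : rel 'I_n :=
  fun u v => [exists d, (src G d == u) && (tgt G d == v)].

Definition connected_graph G : Prop :=
  (0 < n)%N /\ forall u v, connect (adjacent G) u v.

(* On a connected graph n <= m + 1, so the subtraction is not truncated. *)
Definition betti1 G : nat := (m + 1 - n)%N.

Fixpoint is_walk G (u : 'I_n) (p : seq 'I_(m + m)) (v : 'I_n) : bool :=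
  if p is d :: q then (src G d == u) && is_walk G (tgt G d) q v else u == v.

Definition rev_walk (p : seq 'I_(m + m)) : seq 'I_(m + m) := rev (map bar p).

(* Insertion and deletion of backtracks.  For two walks with the same endpoints
   this is homotopy relative to the endpoints: the reduced words of both are
   again walks. *)
Inductive homotopic : seq 'I_(m + m) -> seq 'I_(m + m) -> Prop :=
| homotopic_refl p : homotopic p p
| homotopic_sym p q : homotopic p q -> homotopic q p
| homotopic_trans p q r : homotopic p q -> homotopic q r -> homotopic p r
| homotopic_backtrack p d q : homotopic (p ++ q) (p ++ d :: bar d :: q).

(* The classes of the [g j], closed walks at [v0], generate pi_1(G, v0). *)
Definition generates_pi1 G (v0 : 'I_n) b (g : 'I_b -> seq 'I_(m + m)) : Prop :=
  (forall j, is_walk G v0 (g j) v0) /\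
  forall p, is_walk G v0 p v0 -> exists w : seq ('I_b * bool),
    homotopic p (flatten [seq if jb.2 then g jb.1 else rev_walk (g jb.1)
                         | jb <- w]).

(* Closed walk without backtracking, not even at its base point. *)
Definition reduced_cycle G (c : seq 'I_(m + m)) : Prop :=
  c != [::] /\ path.cycle (fun d d' => (tgt G d == src G d') && (d' != bar d)) c.

(* Cycles C_1, ..., C_beta1 which, joined to a base point by suitable walks,
   generate the fundamental group; as this group is free of rank beta1, they
   are then a free basis.  A cycle representing a generator need not be vertex
   simple.  This matters: for two triangles joined by a bridge, with all
   lengths pi, V = 0 and k = 1, the topological states are the multiples of a
   single one, which is nonzero on all seven edges.  Its support is traversed
   by the reduced cycle a p b p^-1 (a, b the triangles, p the bridge), and
   a p b p^-1, p b p^-1 generate the fundamental group. *)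
Definition generating_cycles G (C : 'I_(betti1 G) -> seq 'I_(m + m)) : Prop :=
  (forall j, reduced_cycle G (C j)) /\
  exists (v0 : 'I_n) (u : 'I_(betti1 G) -> 'I_n)
         (q : 'I_(betti1 G) -> seq 'I_(m + m)),
    [/\ forall j, is_walk G v0 (q j) (u j),
        forall j, is_walk G (u j) (C j) (u j) &
        generates_pi1 G v0 (fun j => q j ++ C j ++ rev_walk (q j))].

End OrientedEdges.

Section Matrices.
Variables (R : realType) (n m : nat) (G : mgraph n m).

Definition delta_t_star : 'M[R[i]]_(n, m + m) :=
  \matrix_(v, d) (tgt G d == v)%:R.

Definition tau_mx : 'M[R[i]]_(m + m) := \matrix_(d', d) (d' == bar d)%:R.

Definition scattering_mx : 'M[R[i]]_(m + m) :=
  \matrix_(d', d)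
    if tgt G d == src G d' then
      2%:R / (degree G (tgt G d))%:R - (d' == bar d)%:R
    else 0.

(* The coordinates of C^(4m) are the pairs (d, l), d an oriented edge, l = 0, 1,
   numbered by [mxtens_index]. *)
Definition scattering_hat : 'M[R[i]]_((m + m) * 2) :=
  scattering_mx *t (1%:M : 'M[R[i]]_2).

Definition tau_hat : 'M[R[i]]_((m + m) * 2) := tau_mx *t (1%:M : 'M[R[i]]_2).

Definition component (l : 'I_2) (x : 'cV[R[i]]_((m + m) * 2)) :
    'cV[R[i]]_(m + m) :=
  \col_d x (mxtens_index (d, l)) 0.

Definition block_diag (B : 'I_(m + m) -> 'M[R[i]]_2) :
    'M[R[i]]_((m + m) * 2) :=
  \matrix_(i, j)
    if (mxtens_unindex i).1 == (mxtens_unindex j).1 then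
      B (mxtens_unindex i).1 (mxtens_unindex i).2 (mxtens_unindex j).2
    else 0.

End Matrices.

Definition col2 (K : Type) (a b : K) : 'cV[K]_2 :=
  \col_i (if i == ord0 then a else b).

Section Schroedinger.
Variable R : realType.
Implicit Types (f g u du : R -> R[i]) (l x : R).

Local Notation mu := (@lebesgue_measure R).

Definition cintegral l f : R[i] :=
  (\int[mu]_(y in `[0, l]) complex.Re (f y)) +i*
  (\int[mu]_(y in `[0, l]) complex.Im (f y)).

(* [f] is absolutely continuous on [0, l], with derivative [g]. *)
Definition ac_derivative l f g : Prop :=
  [/\ mu.-integrable `[0, l] (EFin \o (fun y => complex.Re (g y))),
      mu.-integrable `[0, l] (EFin \o (fun y => complex.Im (g y))) &
      forall x, x \in `[0, l] -> f x = f 0 + cintegral x g].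

(* Solutions in W^{2,1}(0, l), the natural class for an integrable potential
   [q].  As [du] is itself absolutely continuous, it is the derivative of [u]
   everywhere, one-sided at 0 and l. *)
Definition schroedinger l (q : R -> R) (z : R[i]) u du : Prop :=
  ac_derivative l u du /\
  exists d2u, ac_derivative l du d2u /\
    {ae mu, forall x, x \in `[0, l] -> - d2u x + (q x)%:C * u x = z * u x}.

(* One-sided derivative at 0; meaningful when it exists, as for solutions. *)
Definition right_derivative0 f : R[i] :=
  lim ((fun h : R => h^-1 * (complex.Re (f h) - complex.Re (f 0))) @ 0^'+) +i*
  lim ((fun h : R => h^-1 * (complex.Im (f h) - complex.Im (f 0))) @ 0^'+).

End Schroedinger.

Record qgraph (R : realType) (n m : nat) := QGraph {
  graph_of :> mgraph n m;
  len : 'I_m -> R;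
  pot : 'I_m -> R -> R;
  len_gt0 : forall e, 0 < len e;
  pot_integrable : forall e,
    (@lebesgue_measure R).-integrable `[0, len e] (EFin \o pot e)
}.

(* Functions on the metric graph.  The metric graph is the union of its edges:
   only the values of [on_edge f e] on [0, len e] matter, with coordinate
   measured from [tail e], and [at_vertex f] is redundant for the continuous
   functions, see [continuous_at_vertices]. *)
Record gfun (R : realType) (n m : nat) := GFun {
  at_vertex : 'I_n -> R[i];
  on_edge : 'I_m -> R -> R[i]
}.

Section QuantumGraph.
Variables (R : realType) (n m : nat) (G : qgraph R n m).
Implicit Types (phi psi : gfun R n m) (k : R[i]) (d : 'I_(m + m)).

Definition dlen d : R := len G (edge_of d).

(* Functions of the coordinate running from [src d] to [tgt d]. *)
Definition dpot d : R -> R := fun x =>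
  if forward d then pot G (edge_of d) x else pot G (edge_of d) (dlen d - x).

Definition on_dart psi d : R -> R[i] := fun x =>
  if forward d then on_edge psi (edge_of d) x
  else on_edge psi (edge_of d) (dlen d - x).

Definition vanishes_on psi (e : 'I_m) : Prop :=
  forall x, x \in `[0, len G e] -> on_edge psi e x = 0.

Definition outgoing_derivative psi d : R[i] := right_derivative0 (on_dart psi d).

(* Continuity inside the edges is part of [schroedinger]. *)
Definition continuous_at_vertices psi : Prop :=
  forall d, on_dart psi d 0 = at_vertex psi (src G d).

Definition kirchhoff psi : Prop :=
  forall v, \sum_(d | src G d == v) outgoing_derivative psi d = 0.

Definition eigenfunction k psi : Prop :=
  [/\ exists e, ~ vanishes_on psi e,
      continuous_at_vertices psi,
      forall e, exists dpsi,
        schroedinger (len G e) (pot G e) (k ^+ 2) (on_edge psi e) dpsi &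
      kirchhoff psi].

Definition sigma_mx : 'M[R[i]]_2 := diag_mx (\row_i (-1) ^+ i).

(* The second clause determines [Phi d k], since the Cauchy problem at 0 is
   solvable for every initial value; the other two are its standard
   consequences. *)
Definition transfer_matrices (Phi : 'I_(m + m) -> R[i] -> 'M[R[i]]_2) : Prop :=
  forall d k,
  [/\ Phi d k \in unitmx,
      forall u du, schroedinger (dlen d) (dpot d) (k ^+ 2) u du ->
        Phi d k *m col2 (u 0) (du 0) = col2 (u (dlen d)) (du (dlen d)) &
      Phi (bar d) k = sigma_mx *m invmx (Phi d k) *m sigma_mx].

Definition counterpart psi : 'cV[R[i]]_((m + m) * 2) :=
  \col_i (let: (d, l) := mxtens_unindex i in
    if l == ord0 then at_vertex psi (src G d) else outgoing_derivative psi d).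

Definition topological_state (Phi : 'I_(m + m) -> R[i] -> 'M[R[i]]_2) k psi :
    Prop :=
  [/\ eigenfunction k psi,
      (scattering_hat R G + tau_hat R m) *m counterpart psi = 0 &
      (1%:M - block_diag (fun d => Phi d k) *m scattering_hat R G)
        *m counterpart psi = 0].

Definition linear_combination N (c : 'I_N -> R[i]) (psi : 'I_N -> gfun R n m) :
    gfun R n m :=
  GFun (fun v => \sum_i c i * at_vertex (psi i) v)
       (fun e x => \sum_i c i * on_edge (psi i) e x).

Definition agree phi psi : Prop :=
  forall e x, x \in `[0, len G e] -> on_edge phi e x = on_edge psi e x.

Definition linearly_independent N (psi : 'I_N -> gfun R n m) : Prop :=
  forall c : 'I_N -> R[i],
    (forall e, vanishes_on (linear_combination c psi) e) -> forall i, c i = 0.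

Definition topological_basis Phi k N (psi : 'I_N -> gfun R n m) : Prop :=
  [/\ forall i, topological_state Phi k (psi i),
      linearly_independent psi &
      forall phi, topological_state Phi k phi ->
        exists c : 'I_N -> R[i], agree phi (linear_combination c psi)].

(* The edges where [psi] is not identically zero are exactly those of [c]. *)
Definition supported_on psi (c : seq 'I_(m + m)) : Prop :=
  forall e, ~ vanishes_on psi e <-> e \in map (@edge_of m) c.

(* Different basis states belong to different generating cycles. *)
Definition cycle_basis Phi k N (psi : 'I_N -> gfun R n m)
    (C : 'I_(betti1 G) -> seq 'I_(m + m)) (j : 'I_N -> 'I_(betti1 G)) : Prop :=
  [/\ topological_basis Phi k psi, generating_cycles C, injective j &
      forall i, supported_on (psi i) (C (j i))].

Definition dirichlet_eigenvalue (e : 'I_m) (z : R[i]) : Prop :=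
  exists u du, [/\ schroedinger (len G e) (pot G e) z u du,
    u 0 = 0, u (len G e) = 0 & exists2 x, x \in `[0, len G e] & u x != 0].

End QuantumGraph.

(* Main.v *)
Require Import Defs.
From HB Require Import structures.
From mathcomp Require Import all_boot all_order all_algebra.
From mathcomp Require Import all_classical all_reals all_analysis.
From mathcomp.real_closed Require Import complex mxtens.
From mathcomp Require Import ring lra.

Set Implicit Arguments.
Unset Strict Implicit.
Unset Printing Implicit Defensive.

Import Order.TTheory GRing.Theory Num.Theory.
Import numFieldNormedType.Exports.

Local Open Scope classical_set_scope.
Local Open Scope ring_scope.
Local Open Scope complex_scope.

(** Write [x(d) = (psi(s d), b(d))] with [b] the outgoing derivative.  The
    equation [(S + tau) x = 0] says that the [x(d)] with [t d = v] add up to 0,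
    and then [(1 - Phi S) x = 0] becomes [x(d) = - Phi_d x(- d)].  Comparing with
    the transfer relation for [psi] and, since the eigenvalue is real, for its
    conjugate forces [psi = 0] at the vertices.  On an edge [e] where [psi] does
    not vanish, [Phi_e] fixes [(0, 1)] up to a sign [eps_e], so the topological
    states are the vectors [b] with [b(- d) = - eps_e b(d)] whose sums over the
    edges of each sign vanish at every vertex: flows on the edges of sign [+],
    and kernel vectors of the unsigned incidence matrix on those of sign [-].

    If this space is nonzero, it contains a vector whose support is traversed by
    a reduced closed walk that crosses some edge [f] exactly once: a simple cycle
    (even when the sign is [-]), or two odd cycles joined by a path.  Deleting
    [f] keeps the graph connected, removes one generator from the fundamental
    group and cuts the space down by one dimension, and one proceeds by
    induction. *)

(** * Oriented edges, walks and homotopy *)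

(** The number [k] may be any complex number, so the eigenvalue has to be shown real: when the
    Wronskian identity is summed over the edges, the boundary terms cancel by continuity and
    Kirchhoff's condition. On one edge, the relations for [psi], its conjugate and the two
    orientations then make the upper left entry of [Phi_e] a real number of square -1, unless [psi]
    vanishes at both ends.

    Vertex-simple cycles do not suffice, because an odd cycle of sign - carries no vector by itself.
    A circuit may therefore run twice along a connecting path, and its two contributions there must
    add up instead of cancelling. The edge crossed exactly once serves two purposes: it is the pivot
    of a triangular elimination among the vectors, and it splits off one generator of the
    fundamental group. The vectors may be exhausted before the cycles are; the remaining generators
    are then found from ordinary flows, whatever the signs. The result is a list of exactly [betti1]
    cycles whose first members carry the basis. *)

Section Darts.
Variables n m : nat.
Implicit Types (G : mgraph n m) (d : 'I_(m + m)) (p q : seq 'I_(m + m)).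

Lemma edge_of_lshift (e : 'I_m) : edge_of (lshift m e) = e.
Proof. by rewrite /edge_of -/(unsplit (inl e)) unsplitK. Qed.

Lemma edge_of_rshift (e : 'I_m) : edge_of (rshift m e) = e.
Proof. by rewrite /edge_of -/(unsplit (inr e)) unsplitK. Qed.

Lemma bar_lshift (e : 'I_m) : bar (lshift m e) = rshift m e.
Proof. by rewrite /bar -/(unsplit (inl e)) unsplitK. Qed.

Lemma bar_rshift (e : 'I_m) : bar (rshift m e) = lshift m e.
Proof. by rewrite /bar -/(unsplit (inr e)) unsplitK. Qed.

Lemma forward_lshift (e : 'I_m) : forward (lshift m e).
Proof. by rewrite /forward -/(unsplit (inl e)) unsplitK. Qed.

Lemma forward_rshift (e : 'I_m) : forward (rshift m e) = false.
Proof. by rewrite /forward -/(unsplit (inr e)) unsplitK. Qed.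

Variant dart_spec : 'I_(m + m) -> Type :=
| DartForward e : dart_spec (lshift m e)
| DartBackward e : dart_spec (rshift m e).

Lemma dartP d : dart_spec d.
Proof. by rewrite -(splitK d); case: (fintype.split d) => e; constructor. Qed.

Lemma barK : involutive (@bar m).
Proof. by move=> d; case: (dartP d) => e; rewrite !(bar_lshift, bar_rshift). Qed.

Lemma edge_of_bar d : edge_of (bar d) = edge_of d.
Proof.
by case: (dartP d) => e;
  rewrite ?bar_lshift ?bar_rshift edge_of_lshift edge_of_rshift.
Qed.

Lemma edge_of_eq d d' : edge_of d = edge_of d' -> d = d' \/ d = bar d'.
Proof.
by case: (dartP d) => e; case: (dartP d') => e';
  rewrite ?edge_of_lshift ?edge_of_rshift ?bar_lshift ?bar_rshift => ->; auto.
Qed.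

Lemma bar_neq d : bar d != d.
Proof.
case: (dartP d) => e; rewrite ?bar_lshift ?bar_rshift; apply/eqP => /(congr1 (@forward m));
by rewrite forward_lshift forward_rshift.
Qed.

Lemma src_bar G d : src G (bar d) = tgt G d.
Proof. by []. Qed.

Lemma tgt_bar G d : tgt G (bar d) = src G d.
Proof. by rewrite /tgt barK. Qed.

Lemma is_walk_cat G u p w q v :
  is_walk G u p w -> is_walk G u (p ++ q) v = is_walk G w q v.
Proof.
by elim: p u => [|d p IH] u /= => [/eqP -> //|/andP[-> /= /IH]].
Qed.

Lemma is_walk_split G u p q v :
  is_walk G u (p ++ q) v -> exists2 w, is_walk G u p w & is_walk G w q v.
Proof.
elim: p u => [|d p IH] u /=; first by exists u.
by case/andP => -> /IH[w ? ?]; exists w.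
Qed.

Lemma is_walk_rcons G u p d v :
  is_walk G u (rcons p d) v = is_walk G u p (src G d) && (tgt G d == v).
Proof.
elim: p u => [|d' p IH] u /=; first by rewrite eq_sym.
by rewrite IH andbA.
Qed.

Lemma rev_walk_cons d p : rev_walk (d :: p) = rcons (rev_walk p) (bar d).
Proof. by rewrite /rev_walk /= rev_cons. Qed.

Lemma rev_walk_cat p q : rev_walk (p ++ q) = rev_walk q ++ rev_walk p.
Proof. by rewrite /rev_walk map_cat rev_cat. Qed.

Lemma rev_walkK : involutive (@rev_walk m).
Proof. by move=> p; rewrite /rev_walk map_rev revK mapK //; exact: barK. Qed.

Lemma edges_rev_walk p : map (@edge_of m) (rev_walk p) = rev (map (@edge_of m) p).
Proof.
by rewrite /rev_walk map_rev -map_comp; congr rev; apply: eq_map => d /=; rewrite edge_of_bar.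
Qed.

Lemma is_walk_rev G u p v : is_walk G u p v -> is_walk G v (rev_walk p) u.
Proof.
elim: p u => [|d p IH] u /=; first by rewrite eq_sym.
by case/andP => /eqP <- /IH; rewrite rev_walk_cons is_walk_rcons tgt_bar src_bar eqxx andbT.
Qed.

Lemma homotopic_catl r p q : homotopic p q -> homotopic (r ++ p) (r ++ q).
Proof.
elim=> [?|? ? _ ?|? q' ? _ h1 _ h2|p' d q'].
- exact: homotopic_refl.
- exact: homotopic_sym.
- exact: homotopic_trans h1 h2.
- by rewrite !catA; exact: homotopic_backtrack.
Qed.

Lemma homotopic_catr r p q : homotopic p q -> homotopic (p ++ r) (q ++ r).
Proof.
elim=> [?|? ? _ ?|? q' ? _ h1 _ h2|p' d q'].
- exact: homotopic_refl.
- exact: homotopic_sym.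
- exact: homotopic_trans h1 h2.
- by rewrite -!catA; exact: homotopic_backtrack.
Qed.

Lemma homotopic_cat p p' q q' :
  homotopic p p' -> homotopic q q' -> homotopic (p ++ q) (p' ++ q').
Proof. by move=> h h'; apply: homotopic_trans (homotopic_catr _ h) (homotopic_catl _ h'). Qed.

Lemma homotopic_revr p : homotopic (p ++ rev_walk p) [::].
Proof.
elim: p => [|d p IH]; first exact: homotopic_refl.
rewrite rev_walk_cons -cats1 /= catA -cat1s.
apply: homotopic_trans (homotopic_catl [:: d] (homotopic_catr [:: bar d] IH)) _.
exact/homotopic_sym/(homotopic_backtrack [::] d [::]).
Qed.

End Darts.

(** * Generators of the fundamental group *)

Section Generation.
Variables (n m : nat) (G : mgraph n m).
Implicit Types (d : 'I_(m + m)) (p q r w : seq 'I_(m + m)) (A : {set 'I_m}).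

Definition walk_in A p := all (fun d => edge_of d \in A) p.

Lemma walk_in_rev A p : walk_in A (rev_walk p) = walk_in A p.
Proof.
by rewrite /walk_in /rev_walk all_rev all_map; apply: eq_all => d /=; rewrite edge_of_bar.
Qed.

Lemma walk_in_cat A p q : walk_in A (p ++ q) = walk_in A p && walk_in A q.
Proof. exact: all_cat. Qed.

Lemma walk_in_cons A d p : walk_in A (d :: p) = (edge_of d \in A) && walk_in A p.
Proof. by []. Qed.

(** The vertex set stays fixed while edges are deleted, so all of ['I_n] has to remain connected. *)
Definition connected_in A :=
  forall u v, exists2 p, is_walk G u p v & walk_in A p.

Definition word_value (ws : seq (seq 'I_(m + m) * bool)) :=
  flatten [seq if x.2 then x.1 else rev_walk x.1 | x <- ws].

(** Relative to [A] and over a bare list of walks, so that putting back one deleted edge amounts to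
    adding one element to the list. *)
Definition generates_in A (v0 : 'I_n) (gs : seq (seq 'I_(m + m))) :=
  forall p, is_walk G v0 p v0 -> walk_in A p ->
    exists2 ws, all (fun x => x.1 \in gs) ws & homotopic p (word_value ws).

Lemma homotopic_cancelr p w q : homotopic (p ++ w ++ rev_walk w ++ q) (p ++ q).
Proof.
apply: homotopic_catl; rewrite catA.
exact: (homotopic_catr q (homotopic_revr w)).
Qed.

Lemma homotopic_cancell p w q : homotopic (p ++ rev_walk w ++ w ++ q) (p ++ q).
Proof. by rewrite -{2}(rev_walkK w); exact: homotopic_cancelr. Qed.

(* If [d :: w] crosses the edge of [d] only once, then [d] can be replaced by
   [w^-1] up to the generator obtained from [d :: w]. *)
Lemma generates_in_add A d w v0 q gs :
  is_walk G (src G d) (d :: w) (src G d) -> walk_in (A :\ edge_of d) w ->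
  is_walk G v0 q (src G d) -> walk_in (A :\ edge_of d) q ->
  generates_in (A :\ edge_of d) v0 gs ->
  generates_in A v0 ((q ++ (d :: w) ++ rev_walk q) :: gs).
Proof.
move=> /= /andP[_ wW] wA qW qA gen p pW pA.
set g := q ++ _; set A' := A :\ edge_of d in wA qA gen *.
(* Induction on the walk [p] still to be read; [r] is a prefix that already avoids the edge of
   [d]. *)
suff H : forall p u r, is_walk G u p v0 -> walk_in A p ->
    is_walk G v0 r u -> walk_in A' r ->
    exists2 ws, all (fun x => x.1 \in g :: gs) ws & homotopic (r ++ p) (word_value ws).
  by have [] := H p v0 [::] pW pA (eqxx _) isT; move=> ws; exists ws.
have up : forall ws : seq (seq 'I_(m + m) * bool),
    all (fun x => x.1 \in gs) ws -> all (fun x => x.1 \in g :: gs) ws.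
  by move=> ws; apply: sub_all => x /=; rewrite inE => ->; rewrite orbT.
elim=> [|d' p' IH] u r.
  move=> /= /eqP -> _ rW rA; have [ws /up wsP h] := gen r rW rA.
  by exists ws => //; rewrite cats0.
move=> /= /andP[/eqP <- p'W] /andP[d'A p'A] rW rA.
have [e|ne] := eqVneq (edge_of d') (edge_of d); last first.
  have [||ws wsP h] := IH _ (rcons r d') p'W p'A.
  - by rewrite is_walk_rcons rW eqxx.
  - by rewrite /walk_in all_rcons /= inE inE ne d'A.
  - by exists ws => //; rewrite -cat_rcons.
have r1A : forall s, walk_in A' s -> walk_in A' (r ++ s).
  by move=> s sA; rewrite walk_in_cat rA.
have revA : walk_in A' (rev_walk q) by rewrite walk_in_rev.
case: (edge_of_eq e) => dE; subst d'.
(* [r d p'] becomes [(r q^-1) (q d w q^-1) (q w^-1 p')]: the first factor lies in [A'], the second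
   is [g], and the third is left to the induction with prefix [q w^-1]. *)
- have [ws1 ws1P h1] : exists2 ws, all (fun x => x.1 \in gs) ws &
      homotopic (r ++ rev_walk q) (word_value ws).
    apply: gen; last exact: r1A.
    by rewrite (is_walk_cat _ _ rW); exact: is_walk_rev.
  have [||ws2 ws2P h2] := IH _ (q ++ rev_walk w) p'W p'A.
  - by rewrite (is_walk_cat _ _ qW); exact: is_walk_rev.
  - by rewrite walk_in_cat qA walk_in_rev.
  exists (ws1 ++ (g, true) :: ws2).
    by rewrite all_cat (up _ ws1P) /= inE eqxx ws2P.
  rewrite /word_value map_cat flatten_cat /=.
  apply: homotopic_trans; last exact: homotopic_cat h1 (homotopic_catl _ h2).
  rewrite /g -!catA; apply: homotopic_sym.
  apply: homotopic_trans (homotopic_cancell _ _ _) _.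
  rewrite /= -!catA -(cat_cons d w) (catA r (d :: w)).
  apply: homotopic_trans (homotopic_cancell _ _ _) _.
  rewrite -catA cat_cons -!cat_rcons; exact: homotopic_cancelr.
(* Likewise [r d^-1 p'] becomes [(r w q^-1) g^-1 (q p')]. *)
- have [ws1 ws1P h1] : exists2 ws, all (fun x => x.1 \in gs) ws &
      homotopic (r ++ w ++ rev_walk q) (word_value ws).
    apply: gen.
      rewrite (is_walk_cat _ _ rW) src_bar (is_walk_cat _ _ wW); exact: is_walk_rev.
    by apply: r1A; rewrite walk_in_cat wA.
  have [||ws2 ws2P h2] := IH _ q p'W p'A; rewrite ?tgt_bar //.
  exists (ws1 ++ (g, false) :: ws2).
    by rewrite all_cat (up _ ws1P) /= inE eqxx ws2P.
  rewrite /word_value map_cat flatten_cat /=.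
  apply: homotopic_trans; last exact: homotopic_cat h1 (homotopic_catl _ h2).
  rewrite /g rev_walk_cat rev_walk_cons rev_walk_cat rev_walkK -cats1 -!catA; apply: homotopic_sym.
  rewrite (catA r w).
  apply: homotopic_trans (homotopic_cancell _ _ _) _.
  rewrite -catA; apply: homotopic_trans (homotopic_cancelr _ _ _) _.
  rewrite catA; apply: homotopic_trans (homotopic_cancell _ _ _) _.
  rewrite -catA; exact: homotopic_refl.
Qed.

(** The negation says that [A] is a forest: an edge is crossed exactly once by some closed walk if
    and only if it is not a bridge. *)
Definition has_edge_once A :=
  exists d w, [/\ is_walk G (src G d) (d :: w) (src G d), edge_of d \in A &
                  walk_in (A :\ edge_of d) w].

(** Every crossing of the deleted edge is replaced by the detour along [w] or its reverse. *)
Lemma connected_in_remove A d w :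
  is_walk G (src G d) (d :: w) (src G d) -> walk_in (A :\ edge_of d) w ->
  connected_in A -> connected_in (A :\ edge_of d).
Proof.
move=> /= /andP[_ wW] wA con u v.
have [p] := con u v; elim: p u => [|d' p IH] u /=.
  by move=> uv _; exists [::].
move=> /andP[/eqP <- pW] /andP[d'A /(IH _ pW) [q qW qA]].
have [e|ne] := eqVneq (edge_of d') (edge_of d); last first.
  by exists (d' :: q); rewrite ?walk_in_cons /= ?eqxx // inE inE ne d'A.
case: (edge_of_eq e) => dE; subst d'.
- exists (rev_walk w ++ q).
    by rewrite (is_walk_cat _ _ (is_walk_rev wW)).
  by rewrite walk_in_cat qA walk_in_rev wA.
- exists (w ++ q).
    by rewrite src_bar (is_walk_cat _ _ wW) -(tgt_bar G d).
  by rewrite walk_in_cat qA wA.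
Qed.

(** The first edge of a nonempty closed walk must recur. If it recurs in the same direction, the
    walk is a product of two shorter closed walks; if in the opposite one, the part in between is a
    shorter closed walk, and once that is contracted the two crossings form a backtrack. *)
Lemma tree_homotopic A u p : ~ has_edge_once A ->
  is_walk G u p u -> walk_in A p -> homotopic p [::].
Proof.
move=> noC; have [k] := ubnP (size p); elim: k => // k IH in u p *.
case: p => [|d w] /=; first by move=> _ _ _; exact: homotopic_refl.
rewrite ltnS => sz /andP[/eqP du wW] /andP[dA wA].
have [dw|ndw] := boolP (edge_of d \in map (@edge_of m) w); last first.
  case: noC; exists d, w; split => //=; first by rewrite eqxx du.
  apply/allP => d' d'w; rewrite inE inE (allP wA) // andbT.
  by apply: contra ndw => /eqP <-; exact: map_f.
have [d' d'w e] := mapP dw; subst u.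
case/splitPr: d'w => w1 w2 in wW wA sz e *.
rewrite size_cat /= in sz.
have := wA; rewrite walk_in_cat /= => /and3P[w1A d'A w2A].
have [x w1W] := is_walk_split wW; rewrite /= => /andP[/eqP d'x w2W].
have s1 : (size w1 < k)%N by apply: leq_ltn_trans sz; exact: leq_addr.
have s2 : (size w2 < k)%N by apply: leq_ltn_trans sz; rewrite addnS leqW ?leq_addl.
case: (edge_of_eq (esym e)) => dE; subst d' x.
- have h1 : homotopic (d :: w1) [::].
    apply: (IH (src G d)); rewrite /= ?eqxx ?dA //.
    by apply: leq_ltn_trans sz; rewrite addnS ltnS leq_addr.
  have h2 : homotopic (d :: w2) [::].
    apply: (IH (src G d)); rewrite /= ?eqxx ?dA //.
    by apply: leq_ltn_trans sz; exact: leq_addl.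
  exact: homotopic_trans (homotopic_catr (d :: w2) h1) h2.
- have h1 := IH _ w1 s1 w1W w1A.
  rewrite tgt_bar in w2W; have h2 := IH _ _ s2 w2W w2A.
  have /= h3 := homotopic_catl [:: d] (homotopic_catr (bar d :: w2) h1).
  apply: homotopic_trans h3 _.
  apply: homotopic_trans h2.
  exact/homotopic_sym/(homotopic_backtrack [::] d w2).
Qed.

End Generation.

(** * Balanced vectors and the incidence matrix *)

Section Incidence.
Variables (F : fieldType) (n m : nat) (G : mgraph n m).
Implicit Types (A : {set 'I_m}).

(** Here [b] stands for the outgoing derivatives. The two vertex sums are Kirchhoff's condition and,
    up to sign, the vanishing of the sum of the incoming entries. Where [eps] takes the values 1 and
    -1, adding and subtracting them gives one condition for the edges of each sign. *)
Definition balanced (eps : 'I_m -> F) A (b : 'I_(m + m) -> F) :=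
  [/\ forall d, edge_of d \notin A -> b d = 0,
      forall d, b (bar d) = - eps (edge_of d) * b d,
      forall v, \sum_(d | src G d == v) b d = 0 &
      forall v, \sum_(d | src G d == v) eps (edge_of d) * b d = 0].

Lemma sum_src (b : 'I_(m + m) -> F) v :
  \sum_(d | src G d == v) b d =
  \sum_e ((Defs.tail G e == v)%:R * b (lshift m e) + (Defs.head G e == v)%:R * b (rshift m e)).
Proof.
rewrite big_mkcond big_split_ord /= -big_split; apply: eq_bigr => e _ /=.
rewrite /src forward_lshift forward_rshift edge_of_lshift edge_of_rshift.
by congr (_ + _); case: eqP => _; rewrite ?mul1r ?mul0r.
Qed.

Definition incidence A : 'M[F]_(#|A|, n) :=
  \matrix_(i, v) ((Defs.tail G (enum_val i) == v)%:R - (Defs.head G (enum_val i) == v)%:R).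

Lemma sum_delta (v : 'I_n) (f : 'I_n -> F) : \sum_u (v == u)%:R * f u = f v.
Proof.
rewrite (bigD1 v) //= eqxx mul1r big1 ?addr0 // => u.
by rewrite eq_sym => /negPf ->; rewrite mul0r.
Qed.

(** The rows of the incidence matrix sum to 0, so its rank is less than [n] and some combination of
    its rows vanishes. Such flows supply the cycles that carry no state. *)
Lemma balanced_flow A : (0 < n)%N -> (n <= #|A|)%N ->
  exists b, balanced (fun=> 1) A b /\ exists d, b d != 0.
Proof.
move=> n0 nA; set D := incidence A.
have rD : (\rank D < #|A|)%N.
  apply: leq_trans nA; rewrite -mxrank_tr ltn_neqAle rank_leq_row andbT.
  apply/negP => /eqP r; have : row_free D^T by rewrite /row_free r.
  move=> /row_freeP[B DB].
  have one : (const_mx 1 : 'rV_n) *m D^T = 0.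
    apply/matrixP => i j; rewrite !mxE.
    under eq_bigr do rewrite !mxE mul1r.
    have one (v : 'I_n) : \sum_u (v == u)%:R = 1 :> F.
      by rewrite -[RHS](sum_delta v (fun=> 1)); apply: eq_bigr => u _; rewrite mulr1.
    by rewrite sumrB !one subrr.
  have /matrixP/(_ ord0 (Ordinal n0)) : (const_mx 1 : 'rV[F]_n) = 0.
    by rewrite -(mulmx1 (const_mx 1)) -DB mulmxA one mul0mx.
  by rewrite !mxE => /eqP; rewrite oner_eq0.
have : kermx D != 0 by rewrite -mxrank_eq0 mxrank_ker subn_eq0 -ltnNge.
move/matrix0Pn => [i [j kij]]; pose y j := kermx D i j.
have yD v : \sum_j y j * D j v = 0.
  have /matrixP/(_ i v) := mulmx_ker D; rewrite !mxE => {2}<-.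
  by apply: eq_bigr.
(* The kernel vector is indexed by ranks in [A]; [ye] extends it by 0 to all edges. *)
pose ye e := \sum_j y j * (enum_val j == e)%:R.
pose b d := (if forward d then 1 else -1) * ye (edge_of d).
have yeE j' : ye (enum_val j') = y j'.
  rewrite /ye (bigD1 j') //= eqxx mulr1 big1 ?addr0 // => k kj.
  by rewrite (inj_eq enum_val_inj) (negPf kj) mulr0.
have bl e : b (lshift m e) = ye e by rewrite /b forward_lshift edge_of_lshift mul1r.
have br e : b (rshift m e) = - ye e by rewrite /b forward_rshift edge_of_rshift mulN1r.
have bal v : \sum_(d | src G d == v) b d = 0.
  rewrite sum_src; apply: etrans (yD v).
  under eq_bigr do rewrite bl br mulrN -mulrBl mulrC /ye big_distrl /=.
  rewrite exchange_big; apply: eq_bigr => k _ /=.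
  rewrite (bigD1 (enum_val k)) //= eqxx mulr1 big1 ?addr0 ?mxE // => e ne.
  by rewrite eq_sym (negPf ne) mulr0 mul0r.
exists b; split; [split|].
- move=> d dA; rewrite /b /ye big1 ?mulr0 // => k _.
  case: eqP => [e|]; last by rewrite mulr0.
  by rewrite -e enum_valP in dA.
- by move=> d; case: (dartP d) => e; rewrite ?bar_lshift ?bar_rshift bl br mulN1r ?opprK.
- exact: bal.
- by move=> v; under eq_bigr do rewrite mul1r; exact: bal.
- by exists (lshift m (enum_val j)); rewrite bl yeE.
Qed.

(** A vector killed by all edges of [A] is constant along walks, so the incidence matrix has rank at
    least [n - 1], while it has only [#|A|] rows. *)
Lemma connected_in_card A : connected_in G A -> (n <= #|A|.+1)%N.
Proof.
move=> con; case: (posnP n) => [-> //|n0]; set D := incidence A.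
have : (\rank (kermx D^T) <= 1)%N.
  apply: leq_trans (rank_leq_row (const_mx 1 : 'rV[F]_n)); apply: mxrankS.
  apply/row_subP => i; set z := row i _.
  have zD : z *m D^T = 0 by rewrite /z -row_mul mulmx_ker row0.
  clearbody z.
  have zE e : e \in A -> z ord0 (Defs.tail G e) = z ord0 (Defs.head G e).
    move=> eA; have /matrixP/(_ ord0 (enum_rank_in eA e)) := zD.
    rewrite !mxE; under eq_bigr do rewrite !mxE enum_rankK_in // mulrBr !(mulrC (z _ _)).
    by rewrite sumrB !sum_delta => /eqP; rewrite subr_eq0 => /eqP.
  have zc u v : z ord0 u = z ord0 v.
    have [p] := con u v; elim: p u => [|d p IH] u /=; first by move=> /eqP ->.
    move=> /andP[/eqP <- pW] /andP[dA pA]; rewrite -(IH _ pW pA) {IH pW}.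
    case: (dartP d) dA => e; rewrite ?edge_of_lshift ?edge_of_rshift => /zE;
    by rewrite /tgt /src ?bar_lshift ?bar_rshift !forward_lshift !forward_rshift !edge_of_lshift
       !edge_of_rshift.
  have -> : z = z ord0 (Ordinal n0) *: const_mx 1.
    by apply/rowP => v; rewrite !mxE mulr1; exact: zc.
  exact: scalemx_sub.
rewrite mxrank_ker leq_subLR => /leq_trans; apply; rewrite addn1 ltnS mxrank_tr.
exact: rank_leq_row.
Qed.

End Incidence.

(** * The vector carried by a walk *)

Section WalkVector.
Variables (F : numFieldType) (n m : nat) (G : mgraph n m) (s : F).
Hypothesis s2 : s * s = 1.
Implicit Types (A S : {set 'I_m}) (d : 'I_(m + m)) (p q w c : seq 'I_(m + m)).

(** The dart at position [i] of [w] contributes [s ^+ i] to its own entry and [- s ^+ i.+1] to that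
    of its reversal. At each inner vertex the arrival thus cancels the next departure, and the
    vertex sums telescope to the two ends; for a closed walk they vanish once [s ^+ size w = 1]. *)
Fixpoint walk_vec w d : F :=
  if w is d1 :: w' then
    (d1 == d)%:R - s * (d1 == bar d)%:R + s * walk_vec w' d
  else 0.

Lemma bar_inj : injective (@bar m).
Proof. exact: inv_inj (@barK m). Qed.

Lemma eq_bar d d' : (bar d == d') = (d == bar d').
Proof. by rewrite -{1}(barK d') (inj_eq bar_inj). Qed.

Lemma walk_vec_cat p q d : walk_vec (p ++ q) d = walk_vec p d + s ^+ size p * walk_vec q d.
Proof.
elim: p => [|d1 p IH] /=; first by rewrite add0r mul1r.
by rewrite IH exprS; ring.
Qed.

Lemma walk_vec_bar w d : walk_vec w (bar d) = - s * walk_vec w d.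
Proof.
elim: w => [|d1 w IH] /=; first by rewrite mulr0.
rewrite IH barK; set x := _%:R; set y := _%:R; set z := walk_vec _ _.
have -> : - s * (y - s * x + s * z) = - s * y + s * s * x - s * (s * z) by ring.
by rewrite s2; ring.
Qed.

Lemma walk_vec_rev p d : walk_vec (rev_walk p) d = - s ^+ size p * walk_vec p d.
Proof.
elim: p => [|d1 p IH] /=; first by rewrite mulr0.
rewrite rev_walk_cons -cats1 walk_vec_cat IH /rev_walk size_rev size_map /=.
rewrite eq_bar (inj_eq bar_inj) exprS; set x := _%:R; set y := _%:R; set z := walk_vec _ _.
set t := s ^+ _.
have -> : - (s * t) * (y - s * x + s * z) = - s * t * y + s * s * t * x - s * s * t * z by ring.
by rewrite s2; ring.
Qed.

Lemma walk_vec_sum u w v x : is_walk G u w v ->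
  \sum_(d | src G d == x) walk_vec w d = (u == x)%:R - s ^+ size w * (v == x)%:R.
Proof.
have sum1 d1 : \sum_(d | src G d == x) (d1 == d)%:R = (src G d1 == x)%:R :> F.
  case: eqP => [e|ne].
    rewrite (bigD1 d1) ?e //= eqxx big1 ?addr0 // => d /andP[_].
    by rewrite eq_sym => /negPf ->.
  by rewrite big1 // => d /eqP dx; case: eqP => // d1d; case: ne; rewrite d1d.
elim: w u => [|d1 w IH] u /=.
  by move=> /eqP ->; rewrite big1 // mul1r subrr.
case/andP=> /eqP <- /IH {}IH.
rewrite big_split sumrB /= -!mulr_sumr IH sum1.
under eq_bigr do rewrite -eq_bar.
by rewrite sum1 src_bar exprS; ring.
Qed.

Lemma walk_vec_eq0 w d : edge_of d \notin map (@edge_of m) w -> walk_vec w d = 0.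
Proof.
elim: w => //= d1 w IH; rewrite inE negb_or => /andP[ne /IH ->].
have -> : d1 == d = false by apply: contraNF ne => /eqP ->.
have -> : d1 == bar d = false by apply: contraNF ne => /eqP ->; rewrite edge_of_bar.
by rewrite !mulr0 subr0 addr0.
Qed.

Lemma sign_neq0 : s != 0.
Proof. by apply/eqP => s0; move: s2; rewrite s0 mul0r => /esym/eqP; rewrite oner_eq0. Qed.

Lemma walk_vec_trail w d : uniq (map (@edge_of m) w) ->
  (walk_vec w d != 0) = (edge_of d \in map (@edge_of m) w).
Proof.
elim: w => [|d1 w IH] /=; first by rewrite eqxx.
case/andP=> d1w /IH {}IH; rewrite inE; have [e|ne] /= := eqVneq (edge_of d) (edge_of d1).
  rewrite walk_vec_eq0 ?e // mulr0 addr0.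
  case: (edge_of_eq e) => ->.
    by rewrite eqxx (eq_sym _ (bar _)) (negPf (bar_neq _)) mulr0 subr0 oner_neq0.
  by rewrite barK eqxx (eq_sym _ (bar _)) (negPf (bar_neq _)) mulr1 sub0r oppr_eq0 sign_neq0.
have -> : d1 == d = false by apply: contraNF ne => /eqP ->.
have -> : d1 == bar d = false by apply: contraNF ne => /eqP ->; rewrite edge_of_bar.
by rewrite mulr0 subr0 add0r mulf_eq0 (negPf sign_neq0).
Qed.

Lemma walk_vec_balanced eps A u w :
  is_walk G u w u -> walk_in A w -> s ^+ size w = 1 ->
  (forall d, d \in w -> eps (edge_of d) = s) ->
  balanced G eps A (walk_vec w).
Proof.
move=> wW wA sw epsw.
have epsE d : eps (edge_of d) * walk_vec w d = s * walk_vec w d.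
  have [/mapP[d' d'w ->]|nd] := boolP (edge_of d \in map (@edge_of m) w).
    by rewrite epsw.
  by rewrite walk_vec_eq0 ?mulr0.
have sum0 v : \sum_(d | src G d == v) walk_vec w d = 0.
  by rewrite (walk_vec_sum _ wW) sw mul1r subrr.
split=> [d|d|//|v].
- move=> dA; apply: walk_vec_eq0; apply: contra dA => /mapP[d' d'w ->].
  exact: (allP wA).
- by rewrite walk_vec_bar !mulNr epsE.
- by under eq_bigr do rewrite epsE; rewrite -mulr_sumr sum0 mulr0.
Qed.

Lemma path_neq_uniq (T : eqType) (x : T) t :
  uniq (x :: t) -> path (fun y z => y != z) x t.
Proof.
rewrite uniq_pairwise => /pairwise_sorted /=.
by apply: sub_path => y z /=; rewrite eq_sym.
Qed.

Lemma cycle_neq_uniq (T : eqType) (x y : T) t :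
  uniq [:: x, y & t] -> path.cycle (fun a b => a != b) [:: x, y & t].
Proof.
move=> ut; rewrite /path.cycle rcons_path path_neq_uniq //.
move: ut => /andP[+ _]; apply: contra => /eqP lx.
by have := mem_last y t; rewrite -[last y t]/(last x (y :: t)) lx.
Qed.

(** Distinctness of consecutive edges is stronger than absence of backtracks, but it can be read off
    the edge list, where uniqueness gives it at once. *)
Lemma reduced_cycle_edges u d w : is_walk G u (d :: w) u ->
  path.cycle (fun e e' => e != e') (map (@edge_of m) (d :: w)) ->
  reduced_cycle G (d :: w).
Proof.
move=> /= /andP[/eqP du wW]; rewrite -map_rcons path_map => pw; split => //=.
have pathW : forall t d1, is_walk G (tgt G d1) t u ->
    path (fun d d' => tgt G d == src G d') d1 (rcons t d).
  elim=> [|d2 t IH] d1 /=; first by rewrite du andbT.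
  by rewrite eq_sym => /andP[-> /IH].
suff join : forall t d1, path (fun e e' => e != e') (edge_of d1) (map (@edge_of m) t) ->
    path (fun d d' => tgt G d == src G d') d1 t ->
    path (fun d d' => (tgt G d == src G d') && (d' != bar d)) d1 t.
  by apply: join; rewrite ?path_map //; exact: pathW.
elim=> // d2 t IH d1 /= /andP[ne /IH pt] /andP[-> /pt ->].
by rewrite andbT /=; apply: contra ne => /eqP ->; rewrite edge_of_bar.
Qed.

(** The edge of [d] is the one that will be deleted, and the power of [s] makes the walk vector
    balanced. The last clause is a real demand: repeated crossings of an edge could cancel. *)
Definition circuit S := exists d w,
  [/\ is_walk G (src G d) (d :: w) (src G d), reduced_cycle G (d :: w) /\ walk_in S (d :: w),
      edge_of d \notin map (@edge_of m) w, s ^+ size (d :: w) = 1 &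
      forall d', (walk_vec (d :: w) d' != 0) = (edge_of d' \in map (@edge_of m) (d :: w))].

Lemma circuit_trail S u d w : is_walk G u (d :: w) u -> walk_in S (d :: w) ->
  uniq (map (@edge_of m) (d :: w)) -> s ^+ size (d :: w) = 1 -> circuit S.
Proof.
move=> wW wS uw sw.
have du : u = src G d by move: wW => /= /andP[/eqP ->].
exists d, w; split => //; last by move=> d'; exact: walk_vec_trail.
- by rewrite -du.
(* A single loop is its own cyclic neighbour, so its edge list fails the criterion; it is reduced
   because [d] differs from [bar d]. *)
- split=> //; case: w => [|d2 w] in wW uw wS sw *.
    split=> //=; rewrite andbT.
    by move: wW; rewrite /= -du => /andP[_ ->]; rewrite eq_sym bar_neq.
  exact: (reduced_cycle_edges wW (cycle_neq_uniq uw)).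
- by move: uw => /= /andP[].
Qed.

(** The sign -1 of [c'] offsets the change of sign under reversal, so that the way out and the way
    back along [p] reinforce each other, with entries 2 or -2. *)
Lemma circuit_dumbbell S u v d c p c' :
  is_walk G u (d :: c) u -> is_walk G u p v -> is_walk G v c' v ->
  walk_in S ((d :: c) ++ p ++ c') -> uniq (map (@edge_of m) ((d :: c) ++ p ++ c')) ->
  s ^+ size (d :: c) = -1 -> s ^+ size c' = -1 -> circuit S.
Proof.
move=> cW pW c'W wS uw sc sc'.
have du : u = src G d by move: cW => /= /andP[/eqP ->].
pose w := c ++ p ++ c' ++ rev_walk p.
have wE : d :: w = (d :: c) ++ p ++ c' ++ rev_walk p by [].
have wW : is_walk G u (d :: w) u.
  by rewrite wE (is_walk_cat _ _ cW) (is_walk_cat _ _ pW) (is_walk_cat _ _ c'W) is_walk_rev.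
(* The walk [c p c' p^-1] crosses each edge of [p] twice with the same sign. *)
have vecE d' : walk_vec (d :: w) d' =
    walk_vec (d :: c) d' - 2%:R * walk_vec p d' - s ^+ size p * walk_vec c' d'.
  rewrite wE !walk_vec_cat walk_vec_rev sc sc'.
  have : s ^+ size p * s ^+ size p = 1 by rewrite -exprMn s2 expr1n.
  move: (s ^+ size p) => t t2.
  set x := walk_vec (_ :: _) _; set y := walk_vec p _; set z := walk_vec c' _.
  have -> : x + -1 * (y + t * (z + -1 * (- t * y))) = x - y - t * z - t * t * y by ring.
  by rewrite t2; ring.
move: (uw); rewrite !map_cat !cat_uniq => /and3P[ucd /hasPn cd_d /and3P[up /hasPn pd uc']].
exists d, w; split.
- by rewrite -du.
- split; last by move: wS; rewrite wE !walk_in_cat walk_in_rev => /and3P[-> -> ->].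
  apply: (reduced_cycle_edges wW).
  have ul : uniq (map (@edge_of m) (d :: c ++ p ++ c')) by [].
  rewrite /= rcons_path /w !catA map_cat -catA cat_path last_cat.
  rewrite (path_neq_uniq ul) /=.
  (* [l] is the last edge before the return along [p]; it belongs to [c'], which is nonempty because
     [s ^+ 0] is not -1. *)
  set l := last _ _; rewrite edges_rev_walk.
  have lin : l \in map (@edge_of m) c'.
    move: sc'; rewrite /l !map_cat !last_cat.
    case: c' {vecE wW wE w wS uw cW pW c'W ul uc' pd cd_d l} => [|d3 c'].
      by rewrite expr0 => /eqP; rewrite -subr_eq0 opprK -(natrD _ 1 1) pnatr_eq0.
    by move=> _; exact: (mem_last (edge_of d3) (map (@edge_of m) c')).
  have ulp : uniq (l :: rev (map (@edge_of m) p)).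
    by rewrite /= mem_rev rev_uniq up andbT; exact: pd.
  rewrite (path_neq_uniq ulp) /=; apply/negP => /eqP lE.
  have := mem_last l (rev (map (@edge_of m) p)); rewrite lE inE mem_rev => /orP H.
  have : edge_of d \in map (@edge_of m) (d :: c) by rewrite inE eqxx.
  apply/negP; apply: cd_d; rewrite mem_cat.
  by case: H => [/eqP ->|->]; rewrite ?lin ?orbT.
- rewrite /w !map_cat !mem_cat edges_rev_walk mem_rev.
  move: uw; rewrite /= !map_cat !mem_cat => /andP[].
  by rewrite !negb_or => /and3P[-> -> ->].
- rewrite wE !size_cat size_rev size_map !exprD sc sc'.
  have : s ^+ size p * s ^+ size p = 1 by rewrite -exprMn s2 expr1n.
  by move: (s ^+ size p) => t t2; rewrite -[RHS]t2; ring.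
- move=> d'; rewrite vecE wE !map_cat !mem_cat edges_rev_walk mem_rev.
  have sp : s ^+ size p != 0 by rewrite expf_neq0 ?sign_neq0.
  have [d'c|d'c] := boolP (edge_of d' \in map (@edge_of m) (d :: c)).
    have : edge_of d' \notin map (@edge_of m) p ++ map (@edge_of m) c'.
      by apply: contraL d'c => /cd_d.
    rewrite mem_cat negb_or => /andP[d'p d'c'].
    by rewrite (walk_vec_eq0 d'p) (walk_vec_eq0 d'c') !mulr0 !subr0 walk_vec_trail.
  rewrite (walk_vec_eq0 d'c) sub0r.
  have [d'p|d'p] := boolP (edge_of d' \in map (@edge_of m) p).
    have d'c' : edge_of d' \notin map (@edge_of m) c' by apply: contraL d'p => /pd.
    rewrite (walk_vec_eq0 d'c') mulr0 subr0 oppr_eq0 mulf_eq0 negb_or pnatr_eq0.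
    by rewrite walk_vec_trail // d'p.
  rewrite (walk_vec_eq0 d'p) mulr0 oppr0 sub0r oppr_eq0 mulf_eq0 (negPf sp) /=.
  by rewrite walk_vec_trail //= orbF.
Qed.

End WalkVector.

(** * Closed walks in a support without dead ends *)

Section Lasso.
Variables (n m : nat) (G : mgraph n m) (S : {set 'I_m}).
Implicit Types (d : 'I_(m + m)) (p q w c : seq 'I_(m + m)) (X : {set 'I_n}).
Hypothesis extend : forall d, edge_of d \in S ->
  exists d', [/\ edge_of d' \in S, src G d' = tgt G d & d' != bar d].

(** The walk is prolonged without backtracking until it meets [X] or itself. Each vertex it reaches
    is added to [X], and the induction is on the number of vertices outside [X]. *)
Lemma lasso X d : edge_of d \in S -> src G d \in X -> exists q,
  [/\ is_walk G (src G d) (d :: q) (tgt G (last d q)),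
      walk_in S (d :: q) /\ uniq (map (@edge_of m) (d :: q)),
      uniq (map (src G) q), all (fun d' => src G d' \notin X) q &
      (tgt G (last d q) \in X) || (tgt G (last d q) \in map (src G) q)].
Proof.
have [k] := ubnP #|~: X|; elim: k => // k IH in X d *; rewrite ltnS => Xk dS dX.
have [tX|tX] := boolP (tgt G d \in X).
  by exists [::]; split; rewrite //= ?eqxx ?tX //; split; rewrite //= dS.
have [d' [d'S d't nb]] := extend dS.
have [||q [qW [qS qu] us /allP sX end_]] := IH (tgt G d |: X)%SET d' _ d'S.
- apply: leq_trans Xk; apply: proper_card; apply/properP; split.
    by apply/fintype.subsetP => x; rewrite !inE negb_or => /andP[].
  by exists (tgt G d); rewrite !inE ?eqxx.
- by rewrite d't !inE eqxx.
have sX' x : x \in q -> src G x != tgt G d /\ src G x \notin X.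
  by move=> /sX; rewrite !inE negb_or => /andP[].
exists (d' :: q); split.
- by move: qW => /=; rewrite d't !eqxx.
- split; first by rewrite /walk_in /= dS.
  rewrite /= in qu *; rewrite qu andbT inE negb_or; apply/andP; split.
    apply/negP => /eqP e; case: (edge_of_eq (esym e)) => d'E.
      by move: tX; rewrite -d't d'E dX.
    by rewrite d'E eqxx in nb.
  apply/mapP => -[x xq e]; case: (edge_of_eq (esym e)) => xE; have [] := sX' x xq; rewrite xE.
    by rewrite dX.
  by rewrite src_bar eqxx.
- rewrite /= us andbT d't; apply/mapP => -[x /sX'[ne _] e].
  by rewrite -e eqxx in ne.
- by rewrite /= d't tX; apply/allP => x /sX'[].
- move: end_; rewrite /= !inE d't => /orP[/orP[->|->]|->]; rewrite ?orbT //.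
Qed.

(** A lasso that starts with [X] reduced to its origin either returns there or meets itself; in the
    second case its stem is dropped. *)
Lemma simple_cycle_exists d : edge_of d \in S -> exists d1 c,
  [/\ is_walk G (src G d1) (d1 :: c) (src G d1), walk_in S (d1 :: c),
      uniq (map (src G) (d1 :: c)) & uniq (map (@edge_of m) (d1 :: c))].
Proof.
move=> dS; have [|q [qW [qS qu] us sX]] := lasso dS (X := [set src G d]%SET).
  by rewrite inE.
have sd : src G d \notin map (src G) q.
  by apply/mapP => -[x /(allP sX)] + e; rewrite e inE eqxx.
rewrite inE => /orP[/eqP e|].
  exists d, q; split => //; first by rewrite -{2}e.
  by rewrite /= us sd.
case/mapP => z zq e; case/splitPr: zq => q1 q2 in qW qS qu us e *.
move: qW; rewrite -cat_cons => /is_walk_split[x _ zW].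
exists z, q2; split.
- by move: zW; rewrite e /= eqxx => /andP[_ ->].
- by move: qS; rewrite -cat_cons walk_in_cat => /andP[].
- by move: us; rewrite map_cat cat_uniq => /and3P[].
- by move: qu; rewrite -cat_cons map_cat cat_uniq => /and3P[].
Qed.
End Lasso.

Lemma map_uniq_inj (T U : eqType) (f : T -> U) t :
  uniq (map f t) -> {in t &, injective f}.
Proof.
elim: t => // a t IH /= /andP[na ut] x y.
rewrite !inE => /predU1P[->|xt] /predU1P[->|yt] // e.
- by rewrite e map_f in na.
- by rewrite -e map_f in na.
- exact: IH.
Qed.

(** * Even circuits in the support of a vector with zero vertex sums *)

Section Circuits.
Variables (F : numFieldType) (n m : nat) (G : mgraph n m).
Implicit Types (A S : {set 'I_m}) (d : 'I_(m + m)) (p q w c : seq 'I_(m + m)) (s : F).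

Lemma closed_walk_cycle u d c : is_walk G u (d :: c) u ->
  path.cycle (fun d d' => tgt G d == src G d') (d :: c).
Proof.
move=> /= /andP[/eqP du wW].
have pathW : forall t d1, is_walk G (tgt G d1) t u ->
    path (fun d d' => tgt G d == src G d') d1 (rcons t d).
  elim=> [|d2 t IH] d1 /=; first by rewrite du andbT.
  by rewrite eq_sym => /andP[-> /IH].
exact: pathW.
Qed.

Lemma tgt_next u d c x : is_walk G u (d :: c) u -> x \in d :: c ->
  tgt G x = src G (next (d :: c) x).
Proof. by move=> /closed_walk_cycle cC xc; apply/eqP; exact: (next_cycle cC xc). Qed.

Lemma closed_walk_rot u c v : is_walk G u c u -> v \in map (src G) c ->
  exists c1 c2, [/\ c = c1 ++ c2, is_walk G u c1 v & is_walk G v c2 u].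
Proof.
move=> cW /mapP[z zc ->]; case/splitPr: zc cW => c1 c2 /is_walk_split[x c1W].
move=> /= /andP[/eqP zx c2W]; exists c1, (z :: c2); split => //=.
  by rewrite zx.
by rewrite eqxx.
Qed.

(* In a simple cycle of odd length that takes up all of the support at its own
   vertices, [b] would change sign an odd number of times. *)
Lemma odd_cycle_exit (b : 'I_(m + m) -> F) S d c :
  (forall d', (edge_of d' \in S) = (b d' != 0)) ->
  (forall d', b (bar d') = b d') ->
  (forall v, \sum_(d' | src G d' == v) b d' = 0) ->
  is_walk G (src G d) (d :: c) (src G d) -> walk_in S (d :: c) ->
  uniq (map (src G) (d :: c)) -> uniq (map (@edge_of m) (d :: c)) ->
  odd (size (d :: c)) ->
  exists d', [/\ edge_of d' \in S, src G d' \in map (src G) (d :: c) &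
                 edge_of d' \notin map (@edge_of m) (d :: c)].
Proof.
move=> bS bbar bsum cW cS cu eu codd; apply: contrapT => nex.
have inc d' : b d' != 0 -> src G d' \in map (src G) (d :: c) ->
    edge_of d' \in map (@edge_of m) (d :: c).
  by rewrite -bS => d'S d'c; apply: contrapT => /negP d'n; apply: nex; exists d'.
have uc : uniq (d :: c) := map_uniq eu.
have srcI : {in d :: c &, injective (src G)} by exact: map_uniq_inj cu.
(* At the vertex where [y] ends, the only darts with nonzero [b] are [bar y] and the next dart of
   the cycle, so their values are opposite. *)
have step y : y \in d :: c -> b (next (d :: c) y) = - b y.
  move=> yc; set x := next _ y; have xc : x \in d :: c by rewrite mem_next.
  have tyx : tgt G y = src G x by exact: tgt_next cW yc.
  have xny : bar y != x.
    apply/eqP => e; have exy : edge_of x = edge_of y by rewrite -e edge_of_bar.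
    have : x = y by apply: (map_uniq_inj eu).
    by move=> xy; have := bar_neq y; rewrite e xy eqxx.
  have := bsum (src G x); rewrite (bigD1 x) //= (bigD1 (bar y)) /=; last first.
    by rewrite src_bar tyx eqxx.
  rewrite big1 ?addr0 ?bbar => [/eqP|z /andP[/andP[/eqP zx zx'] zy]].
    by rewrite addr_eq0 => /eqP.
  apply/eqP/negPn/negP => bz.
  have := inc z bz; rewrite zx map_f // => /(_ isT) /mapP[t tc e].
  case: (edge_of_eq e) => zt.
    have tx : t = x by apply: srcI => //; rewrite -zt.
    by rewrite zt tx eqxx in zx'.
  have : src G (next (d :: c) t) = src G x.
    by rewrite -(tgt_next cW tc) -src_bar -zt.
  move=> /srcI; rewrite mem_next => /(_ tc xc) ntx.
  by move: zy; rewrite zt -(prev_next uc t) ntx prev_next ?eqxx.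
have : path (fun x y => b y == - b x) d (rcons c d).
  have sub : {subset rcons c d <= d :: c} by move=> z; rewrite mem_rcons.
  have gen t x : fpath (next (d :: c)) x t -> x \in d :: c -> {subset t <= d :: c} ->
      path (fun x y => b y == - b x) x t.
    elim: t x => //= y t IH x /andP[/eqP <- pt] xc st.
    apply/andP; split; first exact/eqP/step.
    apply: IH => // [|z zt]; last by apply: st; rewrite inE zt orbT.
    by have := mem_next (d :: c) x; rewrite xc.
  by apply: gen; rewrite ?mem_head //; exact: (cycle_next uc).
have iter t x : path (fun x y => b y == - b x) x t -> b (last x t) = (-1) ^+ size t * b x.
  elim: t x => [|y t IH] x /=; first by rewrite mul1r.
  by move=> /andP[/eqP yx /IH ->]; rewrite yx exprS mulrN mulN1r mulNr.
move=> /iter; rewrite last_rcons size_rcons -signr_odd codd expr1 mulN1r => /eqP.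
rewrite -addr_eq0 -mulr2n mulrn_eq0 /=; apply/negP.
by rewrite -bS; move: cS => /= /andP[].
Qed.

(** If the first simple cycle has the wrong sign, it is odd and some edge of the support leaves it.
    A lasso along that edge either comes back to the cycle, and one of the two arcs closes it with
    even length, or closes on itself, which gives an even cycle or a dumbbell of two odd ones. *)
Lemma circuit_exists (b : 'I_(m + m) -> F) s S :
  s = 1 \/ s = -1 ->
  (forall d, (edge_of d \in S) = (b d != 0)) ->
  (forall d, b (bar d) = - s * b d) ->
  (forall v, \sum_(d | src G d == v) b d = 0) ->
  (exists d, b d != 0) -> circuit G s S.
Proof.
move=> sE bS bbar bsum [d0 bd0].
have s2 : s * s = 1 by case: sE => ->; ring.
(* A dead end would leave a single nonzero term in a vertex sum. *)
have extend d : edge_of d \in S ->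
    exists d', [/\ edge_of d' \in S, src G d' = tgt G d & d' != bar d].
  move=> dS; apply: contrapT => nex.
  have bbd : b (bar d) != 0 by rewrite -bS edge_of_bar.
  have := bsum (tgt G d); rewrite (bigD1 (bar d)) ?src_bar //= big1 => [|d' /andP[/eqP d't nb]].
    by rewrite addr0 => /eqP; rewrite (negPf bbd).
  by apply/eqP/negPn/negP => bd'; apply: nex; exists d'; rewrite bS.
have d0S : edge_of d0 \in S by rewrite bS.
have [d [c [cW cS cu eu]]] := simple_cycle_exists extend d0S.
have [sc|sc] := eqVneq (s ^+ size (d :: c)) 1; first exact: (circuit_trail s2 cW).
have sN : s = -1 by case: sE sc => // ->; rewrite expr1n eqxx.
have signs p : s ^+ size p = 1 \/ s ^+ size p = -1.
  by rewrite sN -signr_odd; case: odd; rewrite ?expr0 ?expr1; auto.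
have codd : odd (size (d :: c)).
  by move: sc; rewrite sN -signr_odd; case: odd; rewrite ?expr0 ?eqxx.
have {}sc : s ^+ size (d :: c) = -1 by rewrite sN -signr_odd codd.
have bbar1 d' : b (bar d') = b d' by rewrite bbar sN opprK mul1r.
have [d' [d'S d'c nd'c]] := odd_cycle_exit bS bbar1 bsum cW cS cu eu codd.
pose X := [set v | v \in map (src G) (d :: c)]%SET.
have [|q [qW [qS qe] qu qX end_]] := lasso extend d'S (X := X); first by rewrite inE.
have tgtX x : x \in d :: c -> tgt G x \in X.
  by move=> xc; rewrite (tgt_next cW xc) inE map_f // mem_next.
have disj e : e \in map (@edge_of m) (d' :: q) -> e \notin map (@edge_of m) (d :: c).
  rewrite inE => /orP[/eqP -> //|/mapP[x xq ->]].
  apply/mapP => -[y yc /edge_of_eq[] xy]; have := allP qX x xq; rewrite xy.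
    by rewrite inE map_f.
  by rewrite src_bar tgtX.
have [c1 [c2 [cE c1W c2W]]] := closed_walk_rot cW d'c.
have cW' : is_walk G (src G d') (c2 ++ c1) (src G d') by rewrite (is_walk_cat _ _ c2W).
have memc x : (x \in c2 ++ c1) = (x \in d :: c) by rewrite cE !mem_cat orbC.
have memce e : (e \in map (@edge_of m) (c2 ++ c1)) = (e \in map (@edge_of m) (d :: c)).
  by rewrite cE !map_cat !mem_cat orbC.
have sc' : s ^+ size (c2 ++ c1) = -1 by rewrite size_cat addnC -size_cat -cE.
have cS' : walk_in S (c2 ++ c1) by rewrite walk_in_cat andbC -walk_in_cat -cE.
have eu' : uniq (map (@edge_of m) (c2 ++ c1)) by rewrite map_cat uniq_catC -map_cat -cE.
have srcX v : v \in X -> v \in map (src G) (c2 ++ c1).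
  by rewrite inE cE !map_cat !mem_cat orbC.
(* From here on the odd cycle is [k], rotated so as to start where [d'] leaves it. *)
move: {cE c1W c2W} (c2 ++ c1) cW' memc memce sc' cS' eu' srcX => k kW memk memke sk kS ku srcX.
case/orP: end_ => [/srcX endk|].
- have [a1 [a2 [kE a1W a2W]]] := closed_walk_rot kW endk.
  (* The arcs [a1] and [a2] of the odd cycle have lengths of opposite parity, so one of them closes
     [d' :: q] with sign 1. *)
  have [dq|dq] := signs ((d' :: q) ++ rev_walk a1).
    apply: (circuit_trail s2 (w := q ++ rev_walk a1) (u := src G d') (d := d')) => //.
    + by rewrite -cat_cons (is_walk_cat _ _ qW); exact: is_walk_rev.
    + rewrite -cat_cons walk_in_cat qS walk_in_rev.
      by move: kS; rewrite kE walk_in_cat => /andP[].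
    + rewrite -cat_cons map_cat cat_uniq qe edges_rev_walk rev_uniq /=.
      move: ku; rewrite kE map_cat cat_uniq => /and3P[-> _ _]; rewrite andbT.
      apply/hasPn => e; rewrite mem_rev => ea; apply/negP => /disj.
      by rewrite -memke kE map_cat mem_cat ea.
  apply: (circuit_trail s2 (w := q ++ a2) (u := src G d') (d := d')) => //.
  + by rewrite -cat_cons (is_walk_cat _ _ qW).
  + rewrite -cat_cons walk_in_cat qS.
    by move: kS; rewrite kE walk_in_cat => /andP[].
  + rewrite -cat_cons map_cat cat_uniq qe /=.
    move: ku; rewrite kE map_cat cat_uniq => /and3P[_ _ ->]; rewrite andbT.
    apply/hasPn => e ea; apply/negP => /disj.
    by rewrite -memke kE map_cat mem_cat ea orbT.
  + move: dq sk; rewrite kE -cat_cons !size_cat !exprD size_rev size_map.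
    have : s ^+ size a1 * s ^+ size a1 = 1 by rewrite -exprMn s2 expr1n.
    move: (_ ^+ size a1) (_ ^+ size a2) (_ ^+ size (d' :: q)) => x y z xx zx xy.
    have -> : z * y = z * y * (x * x) by rewrite xx mulr1.
    have -> : z * y * (x * x) = (z * x) * (x * y) by ring.
    by rewrite zx xy mulrNN mulr1.
case/mapP => z zq zE; case/splitPr: zq => q1 q2 in qW qS qe zE disj *.
have [x dqW zW] : exists2 x, is_walk G (src G d') (d' :: q1) x &
    is_walk G x (z :: q2) (tgt G (last d' (q1 ++ z :: q2))).
  by apply: is_walk_split; rewrite cat_cons.
have xz : x = src G z by move: zW => /= /andP[/eqP].
rewrite xz zE in dqW zW.
move: qS; rewrite -cat_cons walk_in_cat => /andP[q1S zS].
(* The lasso meets itself at the source of [z]. If its loop is odd too, the stem [d' :: q1] joins it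
   to [k]. *)
have [sz|sz] := signs (z :: q2).
  apply: (circuit_trail s2 zW) => //.
  by move: qe; rewrite -cat_cons map_cat cat_uniq => /and3P[].
case: k => [|k0 k] in kW memk memke sk kS ku srcX *.
  by have := memk d; rewrite mem_head.
apply: (circuit_dumbbell s2 kW dqW zW) => //.
  by rewrite walk_in_cat kS walk_in_cat q1S.
have qe' : uniq (map (@edge_of m) ((d' :: q1) ++ z :: q2)) by [].
rewrite map_cat cat_uniq ku qe' andbT.
by apply/hasPn => e eq; rewrite memke; exact: disj.
Qed.

End Circuits.

(** * A cycle system adapted to the balanced vectors *)

Section CycleSystem.
Variables (F : numFieldType) (n m : nat) (G : mgraph n m).
Implicit Types (A D : {set 'I_m}) (d : 'I_(m + m)) (p q w c : seq 'I_(m + m)).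

(** The circuit is sought in the part [b1] of [b] on the edges of one sign [s]. Since
    [2 b1 = b + s eps b], its vertex sums vanish as well. *)
Lemma balanced_circuit (eps : 'I_m -> F) A b :
  (forall e, e \in A -> eps e = 1 \/ eps e = -1) ->
  balanced G eps A b -> (exists d, b d != 0) ->
  exists d w b',
    [/\ is_walk G (src G d) (d :: w) (src G d),
        reduced_cycle G (d :: w) /\ walk_in A (d :: w),
        edge_of d \notin map (@edge_of m) w,
        balanced G eps A b' &
        forall d', (b' d' != 0) = (edge_of d' \in map (@edge_of m) (d :: w))].
Proof.
move=> epsA [bA bbar bsum besum] [d0 bd0].
have inA d : b d != 0 -> edge_of d \in A.
  by move=> bd; apply: contraNT bd => /bA ->.
pose s := eps (edge_of d0).
have sE : s = 1 \/ s = -1 by apply/epsA/inA.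
have s2 : s * s = 1 by case: sE => ->; ring.
pose b1 d := if eps (edge_of d) == s then b d else 0.
have b1bar d : b1 (bar d) = - s * b1 d.
  by rewrite /b1 edge_of_bar; case: eqP => [<-|]; rewrite ?bbar ?mulr0.
pose S := [set e | b1 (lshift m e) != 0]%SET.
have bS d : (edge_of d \in S) = (b1 d != 0).
  rewrite inE; case: (dartP d) => e; rewrite ?edge_of_lshift // edge_of_rshift.
  by rewrite -bar_lshift b1bar mulf_eq0 oppr_eq0 (negPf (sign_neq0 s2)).
have b1sum v : \sum_(d | src G d == v) b1 d = 0.
  have : \sum_(d | src G d == v) (2%:R * b1 d) = 0.
    transitivity (\sum_(d | src G d == v) b d +
                  s * \sum_(d | src G d == v) eps (edge_of d) * b d); last first.
      by rewrite bsum besum mulr0 addr0.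
    rewrite mulr_sumr -big_split /=.
    apply: eq_bigr => d _; rewrite /b1; have [->|bd] := eqVneq (b d) 0.
      by rewrite if_same; ring.
    have [->|ne] := eqVneq (eps (edge_of d)) s.
      by rewrite mulrA s2 mul1r; ring.
    have : eps (edge_of d) = - s.
      case: (epsA _ (inA _ bd)) sE ne => -> [->|->]; rewrite ?eqxx ?opprK //.
    by move=> ->; rewrite mulrA mulrN s2; ring.
  by rewrite -mulr_sumr => /eqP; rewrite mulf_eq0 pnatr_eq0 => /eqP.
have b1d0 : b1 d0 != 0 by rewrite /b1 eqxx.
have [d [w [wW [wR wS] dw sw wE]]] :=
  circuit_exists sE bS b1bar b1sum (ex_intro _ d0 b1d0).
have SE d' : edge_of d' \in S -> edge_of d' \in A /\ eps (edge_of d') = s.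
  rewrite bS /b1; have [e /inA|_] := eqVneq (eps (edge_of d')) s; first by split.
  by rewrite eqxx.
have wA : walk_in A (d :: w) by apply/allP => d' /(allP wS) /SE[].
exists d, w, (walk_vec s (d :: w)); split => //.
apply: (walk_vec_balanced s2 wW wA sw) => d' d'w.
by have /SE[] := allP wS d' d'w.
Qed.

Lemma balanced_mono (eps : 'I_m -> F) A A' b :
  A' \subset A -> balanced G eps A' b -> balanced G eps A b.
Proof.
move=> /fintype.subsetP sA [bA ? ? ?]; split => // d dA; apply: bA.
by apply: contra dA; exact: sA.
Qed.

Lemma balanced_axpy (eps : 'I_m -> F) A b b' t : balanced G eps A b -> balanced G eps A b' ->
  balanced G eps A (fun d => b d - t * b' d).
Proof.
move=> [h1 h2 h3 h4] [g1 g2 g3 g4]; split=> [d dA|d|v|v].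
- by rewrite h1 // g1 // mulr0 subr0.
- by rewrite h2 g2; ring.
- by rewrite sumrB -mulr_sumr h3 g3 mulr0 subr0.
- under eq_bigr do rewrite mulrBr mulrCA.
  by rewrite sumrB -mulr_sumr h4 g4 mulr0 subr0.
Qed.

(* [A] is the set of edges not yet deleted, [D] that of the edges allowed in the
   supports; connectedness concerns [A] alone. *)
Lemma cycle_system (eps : 'I_m -> F) (v0 : 'I_n) k A D :
  (forall e, e \in D -> eps e = 1 \/ eps e = -1) ->
  connected_in G A -> #|A|.+1 = (n + k)%N ->
  exists (L : seq (seq 'I_(m + m) * seq 'I_(m + m))) (vs : seq ('I_(m + m) -> F)),
  [/\ size L = k,
      forall x, x \in L -> reduced_cycle G x.2 /\
        exists u, is_walk G v0 x.1 u /\ is_walk G u x.2 u,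
      generates_in G A v0 [seq x.1 ++ x.2 ++ rev_walk x.1 | x <- L],
      (size vs <= k)%N /\ forall i, (i < size vs)%N ->
        balanced G eps (A :&: D) (nth (fun=> 0) vs i) /\
        forall d, (nth (fun=> 0) vs i d != 0) =
                  (edge_of d \in map (@edge_of m) (nth ([::], [::]) L i).2) &
      (forall b, balanced G eps (A :&: D) b ->
         exists c : nat -> F, forall d,
           b d = \sum_(i < size vs) c i * nth (fun=> 0) vs i d) /\
      (forall c : nat -> F,
         (forall d, \sum_(i < size vs) c i * nth (fun=> 0) vs i d = 0) ->
         forall i, (i < size vs)%N -> c i = 0)].
Proof.
move=> epsD; have epsA A' e : e \in A' :&: D -> eps e = 1 \/ eps e = -1.
  by rewrite inE => /andP[_]; exact: epsD.
elim: k A => [|k IH] A con cA.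
  (* Now [#|A| = n - 1]: deleting an edge crossed once would leave a connected graph with too few
     edges. So [A] is a spanning tree. *)
  have noC : ~ has_edge_once G A.
    move=> [d [w [wW dA wA]]].
    have := connected_in_card F (connected_in_remove wW wA con).
    by move: cA; rewrite (cardsD1 (edge_of d)) dA addn0 add1n => <-; rewrite ltnn.
  exists [::], [::]; split => //.
  - by move=> p pW pA; exists [::] => //; exact: tree_homotopic noC pW pA.
  - split=> [b bal|//]; exists (fun=> 0) => d; rewrite big_ord0.
    apply/eqP/negPn/negP => bd; apply: noC.
    have [d1 [w [b' [wW [_ wA] dw _ _]]]] := balanced_circuit (epsA A) bal (ex_intro _ d bd).
    move: wA => /= /andP[]; rewrite inE => /andP[dA _] wA; exists d1, w; split => //.
    apply/allP => x xw; have := allP wA x xw; rewrite !inE => /andP[-> _]; rewrite andbT.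
    by apply: contra dw => /eqP <-; exact: map_f.
have step d w : is_walk G (src G d) (d :: w) (src G d) -> walk_in A (d :: w) ->
    edge_of d \notin map (@edge_of m) w ->
    [/\ edge_of d \in A, walk_in (A :\ edge_of d) w, connected_in G (A :\ edge_of d) &
        #|A :\ edge_of d|.+1 = (n + k)%N].
  move=> wW /= /andP[dA wA] dw.
  have wA' : walk_in (A :\ edge_of d) w.
    apply/allP => x xw; rewrite inE inE (allP wA) // andbT.
    by apply: contra dw => /eqP <-; exact: map_f.
  split => //.
  - exact: connected_in_remove wW wA' con.
  - by move: cA; rewrite (cardsD1 (edge_of d)) dA addnS => -[<-].
have sub d : A :\ edge_of d \subset A by rewrite subD1set.
have [[b [bal bn0]]|K0] := pselect (exists b, balanced G eps (A :&: D) b /\ exists d, b d != 0).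
  have [d [w [b' [wW [wR wA] dw bal' b'E]]]] := balanced_circuit (epsA A) bal bn0.
  have wA0 : walk_in A (d :: w).
    by apply: sub_all wA => x; rewrite inE => /andP[].
  have [dA wA' con' cA'] := step d w wW wA0 dw.
  have [L [vs [sL LP gen [svs vsP] [span indep]]]] := IH _ con' cA'.
  have [q qW qA] := con' v0 (src G d).
  have b'd : b' d != 0 by rewrite b'E inE eqxx.
  have vsd (i : 'I_(size vs)) : nth (fun=> 0) vs i d = 0.
    by have [[h _ _ _] _] := vsP i (ltn_ord i); apply: h; rewrite !inE eqxx.
  (* Extending both lists at the head keeps [vs] aligned with an initial segment of [L]; a cycle
     without a vector is added only in the other case, where [vs] is empty. *)
  exists ((q, d :: w) :: L), (b' :: vs); split.
  - by rewrite /= sL.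
  - move=> x; rewrite inE => /predU1P[->|/LP //]; split => //.
    by exists (src G d).
  - exact: generates_in_add.
  - split=> // -[|i] //= /vsP[bi biE]; split => //.
    by apply: balanced_mono bi; exact: finset.setSI.
  - split=> [b2 bal2|c cE].
      (* Elimination with pivot [d]: the difference vanishes on the edge of [d], so it is balanced
         on the smaller edge set. *)
      have bal3 := balanced_axpy (b2 d / b' d) bal2 bal'.
      have [|c cE] := span (fun x => b2 x - b2 d / b' d * b' x).
        case: bal3 => h1 h2 h3 h4; split=> // x.
        rewrite !inE -andbA negb_and negbK => /orP[/eqP e|nx]; last by apply: h1; rewrite inE.
        have hd : b2 d - b2 d / b' d * b' d = 0 by rewrite divfK ?subrr.
        by case: (edge_of_eq e) => ->; rewrite ?h2 hd ?mulr0.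
      exists (fun i => if i is j.+1 then c j else b2 d / b' d) => x.
      by rewrite big_ord_recl /= -cE; ring.
    (* All vectors of [vs] vanish at [d], whose edge was deleted, so the entry at [d] isolates the
       coefficient of [b']. *)
    have c0 : c 0%N = 0.
      have /eqP := cE d; rewrite big_ord_recl /= big1 ?addr0 => [|i _].
        by rewrite mulf_eq0 (negPf b'd) orbF => /eqP.
      by rewrite vsd mulr0.
    case=> [//|i] /= ilt; apply: (indep (fun i => c i.+1)) => // x.
    by have := cE x; rewrite big_ord_recl /= c0 mul0r add0r.
have n0 : (0 < n)%N by apply: leq_ltn_trans (ltn_ord v0).
have nA : (n <= #|A|)%N by move: cA; rewrite addnS => -[->]; rewrite leq_addr.
(* No vector is left, but cycles are: an ordinary flow on all of [A], of sign 1 everywhere, provides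
   the next generator. *)
have [b [bal bn0]] := balanced_flow F G n0 nA.
have [d [w [_ [wW [wR wA] dw _ _]]]] := balanced_circuit (fun _ _ => or_introl erefl) bal bn0.
have [dA wA' con' cA'] := step d w wW wA dw.
have [L [vs [sL LP gen [svs vsP] [span indep]]]] := IH _ con' cA'.
have [q qW qA] := con' v0 (src G d).
exists ((q, d :: w) :: L), [::]; split => //.
- by rewrite /= sL.
- move=> x; rewrite inE => /predU1P[->|/LP //]; split => //.
  by exists (src G d).
- exact: generates_in_add.
- split=> // b2 bal2; exists (fun=> 0) => x; rewrite big_ord0.
  by apply/eqP/negPn/negP => bx; apply: K0; exists b2; split => //; exists x.
Qed.

End CycleSystem.

(** * Absolutely continuous functions on an interval *)

Section RealAC.
Variable R : realType.
Implicit Types (f g h df dg : R -> R) (a b c l x y t e : R).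
Local Notation mu := (@lebesgue_measure R).
Local Notation integ l f := (mu.-integrable `[0, l] (EFin \o f)).
Local Notation I a b f := (\int[mu]_(t in `[a, b]) f t).
Local Notation cont l f := {within `[0, l], continuous f}.

Lemma integS l a b f : 0 <= a -> b <= l -> integ l f ->
  mu.-integrable `[a, b] (EFin \o f).
Proof.
move=> a0 bl; apply: integrableS => //.
by apply: subset_itvScc; rewrite bnd_simp.
Qed.

Lemma int_split l a b f : integ l f -> 0 <= a -> a <= b -> b <= l ->
  I 0 b f = I 0 a f + I a b f.
Proof.
move=> fi a0 ab bl; have fb : integ b f by apply: integS fi.
have := @Rintegral_itvB R f (BLeft 0) (BRight b) a fb.
rewrite !bnd_simp => /(_ a0 ab) h.
rewrite -Rintegral_itv_obnd_cbnd; first by rewrite -h addrC subrK.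
apply: integrableS fb => //.
by apply: subset_itv; rewrite bnd_simp.
Qed.

Lemma integD l f g : integ l f -> integ l g -> integ l (fun x => f x + g x).
Proof.
move=> fi gi; rewrite (_ : _ \o _ = ((EFin \o f) \+ (EFin \o g))%E) //.
exact: integrableD.
Qed.

Lemma integZ l c f : integ l f -> integ l (fun x => c * f x).
Proof.
move=> fi; rewrite (_ : _ \o _ = (fun x => c%:E * (EFin \o f) x)%E) //.
exact: integrableZl.
Qed.

Lemma integ_norm l f : integ l f -> integ l (fun x => `|f x|).
Proof. by move=> fi; exact: (integrable_norm fi). Qed.

Lemma cont_integ l f : cont l f -> integ l f.
Proof. by move=> fc; apply: continuous_compact_integrable => //; exact: segment_compact. Qed.

Lemma integ_cst l c : integ l (fun=> c).
Proof. by apply: cont_integ; apply: continuous_subspaceT => x; exact: cvg_cst. Qed.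

Lemma cont_bounded l f : cont l f -> exists2 M, 0 < M & forall x, 0 <= x <= l -> `|f x| <= M.
Proof.
move=> fc.
have := continuous_compact fc (@segment_compact R 0 l) => /compact_bounded[M [_ H]].
exists (Num.max 1 (M + 1)); first by rewrite lt_max ltr01.
move=> x xl; apply: H; last by exists x => //=; rewrite in_itv.
by rewrite lt_max ltrDl ltr01 orbT.
Qed.

Lemma contM_integ l f g : cont l f -> integ l g -> integ l (fun x => f x * g x).
Proof.
move=> fc gi.
apply: (@integrableMr _ _ _ mu `[0, l]%classic _ f (EFin \o g)) => //.
  by apply: measurable_realfun.subspace_continuous_measurable_fun => //.
have [M M0 fM] := cont_bounded fc.
exists M; split; first exact: num_real.
move=> N MN x /=; rewrite in_itv => /fM fx.
exact: le_trans fx (ltW MN).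
Qed.

Lemma int_cont l f : 0 <= l -> integ l f -> cont l (fun x => I 0 x f).
Proof. by move=> l0 fi; exact: parameterized_integral_continuous. Qed.

Lemma cont_eps l f x e : cont l f -> 0 <= x <= l -> 0 < e ->
  exists2 d, 0 < d & forall y, 0 <= y <= l -> `|y - x| < d -> `|f y - f x| < e.
Proof.
move=> /subspace_continuousP fc xl e0.
have /fc : `[0, l]%classic x by rewrite /= in_itv.
move=> /cvgr_dist_lt /(_ e e0); rewrite near_withinE => -[d /= d0 H].
exists d => // y yl yx; rewrite distrC; apply: H; rewrite /= ?in_itv //.
by rewrite distrC.
Qed.

Lemma cont_closed l f x : cont l f -> 0 < x <= l ->
  (forall y, 0 <= y < x -> f y <= 0) -> f x <= 0.
Proof.
move=> fc /andP[x0 xl] H; rewrite leNgt; apply/negP => fx.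
have xl' : 0 <= x <= l by rewrite ltW.
have [d d0 fd] := cont_eps fc xl' fx.
pose y := Num.max 0 (x - d / 2).
have yx : 0 <= y < x by rewrite le_max lexx /= gt_max x0 /= ltrBlDr ltrDl divr_gt0.
have := fd y; have := H y yx; case/andP: yx => y0 yx fy.
rewrite y0 (ltW (lt_le_trans yx xl)) => /(_ isT).
rewrite ltr0_norm ?subr_lt0 // opprB.
have -> : x - y < d.
  rewrite ltrBlDr -ltrBlDl lt_max; apply/orP; right.
  by rewrite ltrD2l ltrN2 ltr_pdivrMr // ltr_pMr // ltr1n.
move=> /(_ isT); rewrite ltr_norml => /andP[h _].
by have := lt_le_trans h (lexx _); rewrite ltrBrDr addrC subrr ltNge fy.
Qed.

(** Let [s] be the supremum of the points up to which [P] holds throughout. The limit hypothesis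
    gives [P s], and if [s < l] the step would carry [P] beyond [s]. *)
Lemma interval_induction l (P : R -> Prop) : 0 <= l -> P 0 ->
  (forall x, 0 <= x < l -> (forall y, 0 <= y <= x -> P y) ->
     exists2 d, 0 < d & forall y, x <= y <= l -> y <= x + d -> P y) ->
  (forall x, 0 < x <= l -> (forall y, 0 <= y < x -> P y) -> P x) ->
  forall x, 0 <= x <= l -> P x.
Proof.
move=> l0 P0 step lim.
pose E := [set x : R | 0 <= x <= l /\ forall y, 0 <= y <= x -> P y].
have E0 : E 0.
  split; first by rewrite lexx.
  by move=> y; rewrite -eq_le => /eqP <-.
have ubE : ubound E l by move=> x [/andP[]].
have hsE : has_sup E by split; [exists 0|exists l].
pose s := sup E.
have s0 : 0 <= s by apply: ub_le_sup E0; exists l.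
have sl : s <= l by apply: ge_sup => //; exists 0.
have below y : 0 <= y < s -> P y.
  move=> /andP[y0 ys]; have [z [zl Pz] yz] := @sup_gt R E y (ex_intro _ 0 E0) ys.
  by apply: Pz; rewrite y0 ltW.
have Ps : forall y, 0 <= y <= s -> P y.
  move=> y /andP[y0]; rewrite le_eqVlt => /orP[/eqP ->|ys]; last by apply: below; rewrite y0.
  move: s0; rewrite le_eqVlt => /orP[/eqP <- //|s0].
  by apply: lim => //; rewrite s0.
move=> x /andP[x0 xl].
have [xs|sx] := leP x s; first by apply: Ps; rewrite x0.
have sl' : s < l by apply: lt_le_trans sx xl.
have [|d d0 Pd] := step s _ Ps; first by rewrite s0.
pose z := Num.min l (s + d).
have : z <= s.
  apply: ub_le_sup; first by exists l.
  split; first by rewrite ge_min lexx le_min l0 addr_ge0 // ltW.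
  move=> y /andP[y0 yz]; have [ys|sy] := leP y s; first by apply: Ps; rewrite y0.
  by move: yz; rewrite le_min => /andP[yl ysd]; apply: Pd => //; rewrite ltW.
by rewrite leNgt lt_min sl' ltrDl d0.
Qed.

Lemma int_le l a b f g : 0 <= a -> b <= l -> integ l f -> integ l g ->
  (forall t, a <= t <= b -> f t <= g t) -> I a b f <= I a b g.
Proof.
move=> a0 bl fi gi fg; apply: le_Rintegral => //.
- exact: integS fi.
- exact: integS gi.
Qed.

Lemma int_norm l a b f : 0 <= a -> b <= l -> integ l f ->
  `|I a b f| <= I a b (fun t => `|f t|).
Proof. by move=> a0 bl fi; apply: le_normr_Rintegral => //; exact: integS fi. Qed.

Lemma int_add l a b f g : 0 <= a -> b <= l -> integ l f -> integ l g ->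
  I a b (fun t => f t + g t) = I a b f + I a b g.
Proof. by move=> a0 bl fi gi; apply: RintegralD => //; [exact: integS fi|exact: integS gi]. Qed.

Lemma int_scale l a b c f : 0 <= a -> b <= l -> integ l f ->
  I a b (fun t => c * f t) = c * I a b f.
Proof. by move=> a0 bl fi; rewrite RintegralZl //; exact: integS fi. Qed.

Lemma int_cst a b c : a <= b -> I a b (fun=> c) = c * (b - a).
Proof.
move=> ab; rewrite Rintegral_cst //; congr (_ * _).
have := @lebesgue_measure_itv R `[a, b]%R; rewrite /= => ->.
rewrite lte_fin; case: ltgtP ab => // -> _.
by rewrite subrr.
Qed.

Lemma int_ge0 a b f : (forall t, a <= t <= b -> 0 <= f t) -> 0 <= I a b f.
Proof. by move=> f0; apply: Rintegral_ge0 => t /=; rewrite in_itv; exact: f0. Qed.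

Lemma int_eq a b f g : (forall t, a <= t <= b -> f t = g t) -> I a b f = I a b g.
Proof. by move=> fg; apply: eq_Rintegral => t; rewrite inE /= in_itv; exact: fg. Qed.

Lemma int00 a f : I a a f = 0.
Proof. by rewrite set_itv1 Rintegral_set1. Qed.

Definition ac l f df := integ l df /\ forall x, 0 <= x <= l -> f x = f 0 + I 0 x df.

Lemma ac_cont l f df : 0 <= l -> ac l f df -> cont l f.
Proof.
move=> l0 [dfi fE]; apply: (@subspace_eq_continuous _ _ _ (fun x => f 0 + I 0 x df)).
  by move=> x; rewrite inE /= in_itv => /fE.
by move=> x; apply: cvgD; [exact: cvg_cst|exact: int_cont].
Qed.

Lemma ac_diff l f df x y : ac l f df -> 0 <= x -> x <= y -> y <= l ->
  f y - f x = I x y df.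
Proof.
move=> [dfi fE] x0 xy yl; rewrite (fE y) ?(le_trans x0) // (fE x); last first.
  by rewrite x0 (le_trans xy).
by rewrite (int_split dfi x0 xy yl); ring.
Qed.

Lemma ac_mul l f g df dg : 0 <= l -> ac l f df -> ac l g dg ->
  ac l (fun x => f x * g x) (fun x => f x * dg x + g x * df x).
Proof.
move=> l0 af ag; have [dfi fE] := af; have [dgi gE] := ag.
have fc := ac_cont l0 af; have gc := ac_cont l0 ag.
have fdg := contM_integ fc dgi; have gdf := contM_integ gc dfi.
have hi := integD fdg gdf.
split=> // x xl.
set w := fun x => f x * dg x + g x * df x.
pose v t := `|df t| + `|dg t|.
have vi : integ l v by apply: integD; exact: integ_norm.
pose H x := f x * g x - f 0 * g 0 - I 0 x w.
(* The defect [H] of the product rule has increments at most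
   [e * I x y (|f'| + |g'|)] on short intervals [x, y], hence everywhere. *)
suff Hx e : 0 < e -> `|H x| <= e * I 0 x v.
  apply/eqP; rewrite -subr_eq0 opprD addrA -/w -/(H x) -normr_eq0.
  rewrite eq_le normr_ge0 andbT; apply/ler_addgt0Pl => e e0; rewrite addr0.
  have v0 : 0 <= I 0 x v by apply: int_ge0 => t _; rewrite addr_ge0.
  (* The summand 1 keeps the divisor positive even if [v] has integral 0. *)
  have := Hx (e / (1 + I 0 x v)); rewrite divr_gt0 ?ltr_pwDl // => /(_ isT) /le_trans; apply.
  by rewrite -mulrA ger_pMr // mulrC ler_pdivrMr ?mul1r ?lerDr ?ltr_pwDl.
move=> e0; pose K x := `|H x| - e * I 0 x v.
have Hc : cont l H.
  move=> y; apply: cvgB; last exact: int_cont.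
  by apply: cvgB; [apply: cvgM; [exact: fc|exact: gc]|exact: cvg_cst].
have Kc : cont l K.
  move=> y; apply: cvgB; first exact: cvg_norm (Hc y).
  by apply: cvgM; [exact: cvg_cst|exact: int_cont].
suff : K x <= 0 by rewrite subr_le0.
move: x xl; apply: interval_induction => //.
- by rewrite /K /H !int00 subrr subrr mulr0 normr0 subrr.
- move=> x /andP[x0 xl] below.
  have xl' : 0 <= x <= l by rewrite x0 ltW.
  (* [f y] and [f t] are compared through [f x], at the cost of two halves of [e]; [g t] is compared
     with [g x] directly. *)
  have [d1 d10 fd] := cont_eps fc xl' (divr_gt0 e0 (ltr0n _ 2)).
  have [d2 d20 gd] := cont_eps gc xl' e0.
  exists (Num.min d1 d2 / 2).
    by rewrite divr_gt0 // lt_min d10.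
  move=> y /andP[xy yl] yd.
  have y0 := le_trans x0 xy.
  have close t : x <= t <= y -> [/\ 0 <= t <= l, `|t - x| < d1 & `|t - x| < d2].
    move=> /andP[xt ty]; rewrite (le_trans x0 xt) (le_trans ty yl); split => //;
    rewrite ger0_norm ?subr_ge0 //.
      apply: (@le_lt_trans _ _ (Num.min d1 d2 / 2)); first by lra.
      apply: (@lt_le_trans _ _ (Num.min d1 d2)); last by rewrite ge_min lexx.
      by rewrite ltr_pdivrMr // ltr_pMr ?ltr1n // lt_min d10.
    apply: (@le_lt_trans _ _ (Num.min d1 d2 / 2)); first by lra.
    apply: (@lt_le_trans _ _ (Num.min d1 d2)); last by rewrite ge_min lexx orbT.
    by rewrite ltr_pdivrMr // ltr_pMr ?ltr1n // lt_min d10.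
  have Kx : K x <= 0 by apply: below; rewrite x0 lexx.
  have dH : `|H y - H x| <= e * I x y v.
    have cI1 : integ l (fun t => f y * dg t + g x * df t) by apply: integD; exact: integZ.
    (* From [f y * g y - f x * g x = f y * (g y - g x) + g x * (f y - f x)], so that the factors in
       front of the derivatives are constants. *)
    have -> : H y - H x = I x y (fun t => (f y * dg t + g x * df t) + -1 * w t).
      rewrite (@int_add l) // ?(@int_scale l x y (-1)) //; last exact: integZ.
      rewrite (@int_add l) //; try exact: integZ.
      rewrite !(@int_scale l) // -(ac_diff af) // -(ac_diff ag) //.
      by rewrite /H (int_split hi x0 xy yl); ring.
    have wI : integ l (fun t => (f y * dg t + g x * df t) + -1 * w t).
      by apply: integD => //; exact: integZ.
    apply: le_trans (int_norm x0 yl wI) _.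
    rewrite -(@int_scale l) //; apply: (@int_le l) => //.
    + exact: integ_norm.
    + exact: integZ.
    + move=> t xty; have [tl td1 td2] := close t xty.
      have [yl' yd1 _] : [/\ 0 <= y <= l, `|y - x| < d1 & `|y - x| < d2].
        by apply: close; rewrite xy lexx.
      have -> : f y * dg t + g x * df t + -1 * w t =
                (f y - f t) * dg t + (g x - g t) * df t by rewrite /w; ring.
      apply: le_trans (ler_normD _ _) _; rewrite !normrM /v mulrDr addrC.
      apply: lerD; apply: ler_wpM2r => //.
        by rewrite distrC ltW // gd.
      have -> : f y - f t = (f y - f x) - (f t - f x) by ring.
      apply: le_trans (ler_normB _ _) _.
      by have := fd y yl' yd1; have := fd t tl td1; lra.
  have : `|H y| <= `|H x| + `|H y - H x|.
    by rewrite -{1}(subrK (H x) (H y)) addrC; exact: ler_normD.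
  move: Kx; rewrite /K (int_split vi x0 xy yl) mulrDr; move: dH; lra.
- by move=> x xl K0; apply: cont_closed Kc xl K0.
Qed.

(** Continuous induction: if [Y] vanishes up to [x] and [h] has integral below 1/2 on a short
    interval after [x], the maximum [M] of [Y] there satisfies [M <= M / 2]. *)
Lemma gronwall0 l (Y : R -> R) h : 0 <= l -> cont l Y -> integ l h ->
  (forall t, 0 <= t <= l -> 0 <= Y t) -> (forall t, 0 <= h t) ->
  (forall t, 0 <= t <= l -> Y t <= I 0 t (fun s => Y s * h s)) ->
  forall t, 0 <= t <= l -> Y t = 0.
Proof.
move=> l0 Yc hi Y0 h0 YI t tl.
have Yhi := contM_integ Yc hi.
have hc := int_cont l0 hi.
apply/eqP; rewrite eq_le Y0 // andbT; move: t tl; apply: interval_induction => //.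
- by apply: le_trans (YI 0 _) _; rewrite ?int00 ?lexx.
- move=> x /andP[x0 xl] below.
  have xl' : 0 <= x <= l by rewrite x0 ltW.
  have [d d0 hd] := cont_eps hc xl' (divr_gt0 ltr01 (ltr0n _ 2)).
  exists (d / 2); first by rewrite divr_gt0.
  move=> y /andP[xy yl] yd.
  have sub : {within `[x, y], continuous Y}.
    apply: continuous_subspaceW Yc; apply: subset_itvScc; rewrite bnd_simp //.
  have [c] := EVT_max xy sub; rewrite in_itv /= => /andP[xc cy] Ymax.
  have c0 := le_trans x0 xc; have cl := le_trans cy yl.
  have cl' : 0 <= c <= l by rewrite c0.
  have cd : `|c - x| < d by rewrite ger0_norm ?subr_ge0 //; lra.
  have hxc : I x c h < 1 / 2.
    have := hd c cl' cd; rewrite (int_split hi x0 xc cl) addrAC subrr add0r.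
    by rewrite ger0_norm //; apply: int_ge0.
  have : Y c <= Y c * I x c h.
    apply: le_trans (YI c cl') _; rewrite (int_split Yhi x0 xc cl).
    have -> : I 0 x (fun s => Y s * h s) = 0.
      rewrite (@int_eq _ _ _ (fun=> 0)) ?int_cst ?mul0r // => t /andP[t0 tx].
      have -> : Y t = 0.
        apply/eqP; rewrite eq_le below ?t0 //= Y0 // t0 (le_trans tx) //.
        by case/andP: xl'.
      by rewrite mul0r.
    rewrite add0r -(@int_scale l) //; apply: (@int_le l) => //; first exact: integZ.
    move=> t /andP[xt tc]; apply: ler_wpM2r => //; apply: Ymax.
    by rewrite in_itv /= xt (le_trans tc).
  have Yc0 := Y0 c cl'; have h0' : 0 <= I x c h by apply: int_ge0.
  move=> Yle; have : Y y <= Y c by apply: Ymax; rewrite in_itv /= xy lexx.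
  move=> /le_trans; apply.
  have : Y c * I x c h <= Y c * (1 / 2) by apply: ler_wpM2l => //; exact: ltW.
  lra.
- by move=> x xl below; apply: cont_closed Yc xl below.
Qed.

Lemma cont_int0 l f : 0 < l -> cont l f -> (forall x, 0 <= x <= l -> 0 <= f x) ->
  I 0 l f = 0 -> forall x, 0 <= x <= l -> f x = 0.
Proof.
move=> l0 fc f0 fI x xl; apply/eqP; rewrite eq_le f0 // andbT.
have fi := cont_integ fc.
have main c : 0 <= c < l -> f c <= 0.
  move=> /andP[c0 cl]; rewrite leNgt; apply/negP => fc0.
  have cl' : 0 <= c <= l by rewrite c0 ltW.
  have [d d0 fd] := cont_eps fc cl' (divr_gt0 fc0 (ltr0n _ 2)).
  pose b := Num.min l (c + d / 2).
  have cb : c < b by rewrite lt_min cl ltrDl divr_gt0.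
  have bl : b <= l by rewrite ge_min lexx.
  have bd : b <= c + d / 2 by rewrite ge_min lexx orbT.
  have : I 0 l f = I 0 c f + (I c b f + I b l f).
    rewrite (int_split fi c0 (ltW cl) (lexx _)); congr (_ + _).
    have := int_split fi c0 (ltW cb) bl.
    have := int_split fi (le_trans c0 (ltW cb)) bl (lexx _).
    have := int_split fi c0 (ltW cl) (lexx _); lra.
  have : f c / 2 * (b - c) <= I c b f.
    rewrite -int_cst ?(ltW cb) //; apply: (@int_le l) => //; first exact: integ_cst.
    move=> t /andP[ct tb].
    have tl : 0 <= t <= l by rewrite (le_trans c0 ct) (le_trans tb bl).
    have := fd t tl; rewrite ger0_norm ?subr_ge0 // => /(_ _)/ltr_normlP[|h _]; last by lra.
    by lra.
  have : 0 < f c / 2 * (b - c) by rewrite mulr_gt0 ?divr_gt0 ?subr_gt0.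
  have : 0 <= I 0 c f.
    by apply: int_ge0 => t /andP[t0 tc]; apply: f0; rewrite t0 (le_trans tc) // ltW.
  have : 0 <= I b l f.
    apply: int_ge0 => t /andP[bt tl]; apply: f0; rewrite tl andbT.
    exact: le_trans (le_trans c0 (ltW cb)) bt.
  by rewrite fI; lra.
have [x0 xl'] := andP xl; have [xE|xlt] := eqVneq x l; last first.
  by apply: main; rewrite x0 lt_neqAle xlt.
rewrite xE; apply: cont_closed fc _ main; by rewrite l0 lexx.
Qed.

Lemma ac_right_derivative l f df : 0 < l -> ac l f df -> cont l df ->
  (fun h : R => h^-1 * (f h - f 0)) @ 0^'+ --> df 0.
Proof.
move=> l0 af dfc; apply/cvgrPdist_le => e e0.
have ll : (0 : R) <= 0 <= l by rewrite lexx ltW.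
have [d d0 dfd] := cont_eps dfc ll e0.
have [dfi _] := af.
near=> h.
have h0 : 0 < h by [].
have hl : h <= l by near: h; exact: nbhs_right_le.
have hd : h < d by near: h; exact: nbhs_right_lt.
have h0' := ltW h0; rewrite (ac_diff af (lexx 0) h0' hl).
have -> : df 0 - h^-1 * I 0 h df = h^-1 * I 0 h (fun t => df 0 + -1 * df t).
  rewrite (@int_add l) ?int_cst ?(@int_scale l) ?integ_cst ?integZ //.
  by field; rewrite gt_eqF.
rewrite normrM gtr0_norm ?invr_gt0 // mulrC ler_pdivrMr //.
apply: le_trans (@int_norm l _ _ _ _ _ _) _ => //.
  by apply: integD; [exact: integ_cst|exact: integZ].
rewrite -[h in e * h]subr0 -int_cst //; apply: (@int_le l) => //.
- by apply: integ_norm; apply: integD; [exact: integ_cst|exact: integZ].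
- exact: integ_cst.
- move=> t /andP[t0 th]; rewrite mulN1r distrC ltW // dfd //.
    by rewrite t0 (le_trans th).
  by rewrite subr0 ger0_norm // (le_lt_trans th).
Unshelve. all: by end_near. Qed.

Lemma ac_left_derivative l f df : 0 < l -> ac l f df -> cont l df ->
  (fun h : R => h^-1 * (f (l - h) - f l)) @ 0^'+ --> - df l.
Proof.
move=> l0 af dfc; apply/cvgrPdist_le => e e0.
have ll : 0 <= l <= l by rewrite lexx ltW.
have [d d0 dfd] := cont_eps dfc ll e0.
have [dfi _] := af.
near=> h.
have h0 : 0 < h by [].
have hl : h <= l by near: h; exact: nbhs_right_le.
have hd : h < d by near: h; exact: nbhs_right_lt.
have lh0 : 0 <= l - h by rewrite subr_ge0.
have lhl : l - h <= l by rewrite gerBl ltW.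
have -> : f (l - h) - f l = - I (l - h) l df by rewrite -(ac_diff af) // opprB.
have -> : - df l - h^-1 * - I (l - h) l df =
    h^-1 * I (l - h) l (fun t => - df l + df t).
  rewrite (@int_add l) ?int_cst ?integ_cst //.
  by field; rewrite gt_eqF.
rewrite normrM gtr0_norm ?invr_gt0 // mulrC ler_pdivrMr //.
apply: le_trans (@int_norm l _ _ _ _ _ _) _ => //.
  by apply: integD; [exact: integ_cst|].
have -> : e * h = I (l - h) l (fun=> e) by rewrite int_cst //; ring.
apply: (@int_le l) => //.
- by apply: integ_norm; apply: integD; [exact: integ_cst|].
- exact: integ_cst.
- move=> t /andP[lt tl]; rewrite addrC ltW // dfd ?(le_trans lh0) //.
  by rewrite ler0_norm ?subr_le0 // opprB; lra.
Unshelve. all: by end_near. Qed.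

End RealAC.

(** * Solutions of the Schroedinger equation *)

Section Solutions.
Variable R : realType.
Implicit Types (l x y t : R) (u v du dv : R -> R[i]) (z c : R[i]).
Local Notation mu := (@lebesgue_measure R).
Local Notation integ l f := (mu.-integrable `[0, l] (EFin \o f)).
Local Notation I a b f := (\int[mu]_(t in `[a, b]) f t).
Local Notation cont l f := {within `[0, l], continuous f}.
Local Notation re := (@complex.Re R).
Local Notation im := (@complex.Im R).

Lemma reD (a b : R[i]) : re (a + b) = re a + re b. Proof. by case: a b => [? ?] [? ?]. Qed.
Lemma imD (a b : R[i]) : im (a + b) = im a + im b. Proof. by case: a b => [? ?] [? ?]. Qed.
Lemma reN (a : R[i]) : re (- a) = - re a. Proof. by case: a. Qed.
Lemma imN (a : R[i]) : im (- a) = - im a. Proof. by case: a. Qed.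
Lemma reM (a b : R[i]) : re (a * b) = re a * re b - im a * im b.
Proof. by case: a b => [? ?] [? ?]. Qed.
Lemma imM (a b : R[i]) : im (a * b) = re a * im b + im a * re b.
Proof. by case: a b => [? ?] [? ?]. Qed.
Lemma complex_ext (a b : R[i]) : re a = re b -> im a = im b -> a = b.
Proof. by case: a b => [? ?] [? ?] /= -> ->. Qed.

Lemma ac_eq l (f g df dg : R -> R) : 0 <= l -> (forall x, 0 <= x <= l -> f x = g x) ->
  (forall x, 0 <= x <= l -> df x = dg x) -> ac l f df -> ac l g dg.
Proof.
move=> l0 fg dfg [dfi fE]; split.
  apply: eq_integrable dfi => // x; rewrite inE /= in_itv => /dfg.
  by move=> /= ->.
move=> x xl; rewrite -fg // -fg ?lexx // fE //; congr (_ + _).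
apply: int_eq => t /andP[t0 tx]; apply: dfg; rewrite t0.
by case/andP: xl => _; exact: le_trans.
Qed.

Lemma ac_axpy l (a b : R) (f g df dg : R -> R) : 0 <= l -> ac l f df -> ac l g dg ->
  ac l (fun x => a * f x + b * g x) (fun x => a * df x + b * dg x).
Proof.
move=> l0 [dfi fE] [dgi gE]; split; first by apply: integD; exact: integZ.
move=> x xl; have [_ xl'] := andP xl.
rewrite (fE x xl) (gE x xl) (@int_add _ l) //; try exact: integZ.
by rewrite !(@int_scale _ l) //; ring.
Qed.

Lemma ae_impl (P Q : R -> Prop) : (forall x, P x -> Q x) ->
  {ae mu, forall x, P x} -> {ae mu, forall x, Q x}.
Proof. by move=> PQ; apply: filterS; first exact: (ae_filter_ringOfSetsType mu). Qed.

Lemma ac_ae l (f df dg : R -> R) : ac l f df -> integ l dg ->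
  {ae mu, forall x, x \in `[0, l] -> df x = dg x} -> ac l f dg.
Proof.
move=> [dfi fE] dgi dfg; split=> // x xl; rewrite fE //; congr (_ + _).
have [_ xl'] := andP xl.
have sub f' : integ l f' -> mu.-integrable `[0, x] (EFin \o f').
  by move=> ?; apply: (@integS _ l).
rewrite /Rintegral; congr fine; apply: ae_eq_integral => //.
- exact: measurable_int (sub _ dfi).
- exact: measurable_int (sub _ dgi).
- apply: ae_impl dfg => t /= H; rewrite in_itv /= => /andP[t0 tx].
  by rewrite H // in_itv /= t0 (le_trans tx).
Qed.

(** The equation for the second derivative is built into the densities, so it holds pointwise and
    not only almost everywhere, and the real lemmas about [ac] apply to each component. *)
Definition real_system l (q : R -> R) z u du :=
  [/\ ac l (re \o u) (re \o du), ac l (im \o u) (im \o du),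
      ac l (re \o du) (fun t => (q t - re z) * re (u t) + im z * im (u t)) &
      ac l (im \o du) (fun t => (q t - re z) * im (u t) - im z * re (u t))].

Lemma ac_derivativeP l (f g : R -> R[i]) : ac_derivative l f g <->
  ac l (re \o f) (re \o g) /\ ac l (im \o f) (im \o g).
Proof.
split.
  move=> [gr gi fE]; split; split => // x xl; rewrite /= fE ?in_itv //.
    by rewrite reD.
  by rewrite imD.
move=> [[gr rE] [gi iE]]; split => // x; rewrite in_itv /= => xl.
by apply: complex_ext; rewrite ?reD ?imD; [exact: rE|exact: iE].
Qed.

Lemma schroedingerP l (q : R -> R) z u du : 0 <= l -> integ l q ->
  schroedinger l q z u du <-> real_system l q z u du.
Proof.
move=> l0 qi; split.
  move=> [/ac_derivativeP[ur ui] [d2u [/ac_derivativeP[dr di] ae]]].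
  have uc := ac_cont l0 ur; have vc := ac_cont l0 ui.
  have qre (b : R) (f g : R -> R) : cont l f -> cont l g ->
      integ l (fun t => (q t - re z) * f t + b * g t).
    move=> fc gc; apply: integD; last by apply: integZ; exact: cont_integ.
    have : integ l (fun t => f t * (q t + - re z)).
      by apply: contM_integ => //; apply: integD => //; exact: integ_cst.
    by apply: eq_integrable => // t _ /=; rewrite mulrC.
  split=> //.
  - apply: (ac_ae dr); first exact: qre.
    apply: ae_impl ae => t H /H /(congr1 re) /=; rewrite reD reN !reM /=; lra.
  - apply: (ac_ae di).
      by have := qre (- im z) _ _ vc uc; apply: eq_integrable => // t _ /=; rewrite mulNr.
    apply: ae_impl ae => t H /H /(congr1 im) /=; rewrite imD imN !imM /=; lra.
move=> [ur ui dr di]; split; first exact/ac_derivativeP.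
exists (fun t => (q t)%:C * u t - z * u t); split.
  apply/ac_derivativeP; split.
    apply: ac_eq dr => // t _ /=; rewrite reD reN !reM /=; ring.
  by apply: ac_eq di => // t _ /=; rewrite imD imN !imM /=; ring.
by apply: aeW => t _; ring.
Qed.

Lemma schroedinger_axpy l q z c u v du dv : 0 <= l -> integ l q ->
  schroedinger l q z u du -> schroedinger l q z v dv ->
  schroedinger l q z (fun x => c * u x + v x) (fun x => c * du x + dv x).
Proof.
move=> l0 qi /(schroedingerP _ _ _ l0 qi)[ur ui dur dui].
move=> /(schroedingerP _ _ _ l0 qi)[vr vi dvr dvi].
apply/(schroedingerP _ _ _ l0 qi).
have comb (f g h df dg dh : R -> R) a b : ac l f df -> ac l g dg -> ac l h dh ->
    ac l (fun x => a * f x + b * g x + h x) (fun x => a * df x + b * dg x + dh x).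
  move=> af ag ah; have := ac_axpy 1 1 l0 (ac_axpy a b l0 af ag) ah.
  by apply: ac_eq => // x _; rewrite !mul1r.
split.
- by apply: ac_eq (comb _ _ _ _ _ _ (re c) (- im c) ur ui vr) => // x _ /=;
    rewrite reD reM; ring.
- by apply: ac_eq (comb _ _ _ _ _ _ (re c) (im c) ui ur vi) => // x _ /=;
    rewrite imD imM; ring.
- by apply: ac_eq (comb _ _ _ _ _ _ (re c) (- im c) dur dui dvr) => // x _ /=;
    rewrite !reD !reM ?imD ?imM; ring.
- by apply: ac_eq (comb _ _ _ _ _ _ (re c) (im c) dui dur dvi) => // x _ /=;
    rewrite !imD !imM ?reD ?reM; ring.
Qed.

Lemma schroedinger0 l q z : 0 <= l -> integ l q ->
  schroedinger l q z (fun=> 0) (fun=> 0).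
Proof.
move=> l0 qi; apply/(schroedingerP _ _ _ l0 qi).
have ac0 : ac l (fun=> 0) (fun=> 0).
  split; first exact: integ_cst.
  by move=> x /andP[x0 _]; rewrite int_cst // mul0r addr0.
by split; apply: ac_eq ac0 => // x _ /=; ring.
Qed.

Lemma schroedinger_scale l q z c u du : 0 <= l -> integ l q ->
  schroedinger l q z u du -> schroedinger l q z (fun x => c * u x) (fun x => c * du x).
Proof.
move=> l0 qi us.
have := schroedinger_axpy c l0 qi us (schroedinger0 z l0 qi).
by congr schroedinger; apply: funext => x; rewrite addr0.
Qed.

Lemma schroedinger_conj l q z u du : 0 <= l -> integ l q -> im z = 0 ->
  schroedinger l q z u du -> schroedinger l q z (fun x => (u x)^*) (fun x => (du x)^*).
Proof.
move=> l0 qi z0 /(schroedingerP _ _ _ l0 qi)[ur ui dur dui].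
apply/(schroedingerP _ _ _ l0 qi).
have neg (f df : R -> R) : ac l f df -> ac l (fun x => - f x) (fun x => - df x).
  move=> af; have := ac_axpy (-1) 0 l0 af af.
  by apply: ac_eq => // x _; ring.
split.
- by apply: ac_eq ur => // x _ /=; case: (u x); case: (du x).
- by apply: ac_eq (neg _ _ ui) => // x _ /=; case: (u x); case: (du x).
- by apply: ac_eq dur => // x _ /=; rewrite ?z0; case: (u x) => ? ?; case: (du x) => ? ? /=; ring.
- by apply: ac_eq (neg _ _ dui) => // x _ /=; rewrite ?z0; case: (u x) => ? ?; case: (du x) => ? ? /=; ring.
Qed.

Lemma schroedinger_unique l q z u du : 0 <= l -> integ l q ->
  schroedinger l q z u du -> u 0 = 0 -> du 0 = 0 -> forall x, 0 <= x <= l -> u x = 0.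
Proof.
move=> l0 qi /(schroedingerP _ _ _ l0 qi)[ur ui dur dui] u0 du0.
pose Y t := `|re (u t)| + `|im (u t)| + (`|re (du t)| + `|im (du t)|).
(* Each of the four terms of [Y] has a derivative of size at most [Y * h / 4], whence the factor
   4. *)
pose h t := 4 * (1 + `|q t - re z| + `|im z|).
have c1 := ac_cont l0 ur; have c2 := ac_cont l0 ui.
have c3 := ac_cont l0 dur; have c4 := ac_cont l0 dui.
have Yc : cont l Y.
  move=> x; apply: cvgD; apply: cvgD; apply: cvg_norm.
  - exact: c1.
  - exact: c2.
  - exact: c3.
  - exact: c4.
have hi : integ l h.
  apply: integZ; apply: integD; last exact: integ_cst.
  apply: integD; first exact: integ_cst.
  by apply: integ_norm; apply: integD => //; exact: integ_cst.
have Yh : integ l (fun t => Y t * h t) by apply: contM_integ.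
have bound (f df : R -> R) (k : R -> R) t : ac l f df -> f 0 = 0 -> integ l k ->
    (forall s, 0 <= s <= l -> `|df s| <= k s) -> 0 <= t <= l -> `|f t| <= I 0 t k.
  move=> af f0 ki dk tl; have [dfi fE] := af; have [t0 tl'] := andP tl.
  rewrite fE // f0 add0r.
  apply: le_trans (@int_norm _ l _ _ _ (lexx 0) tl' dfi) _.
  apply: (@int_le _ l) => //; first exact: integ_norm.
  by move=> s /andP[s0 st]; apply: dk; rewrite s0 (le_trans st).
pose g t := `|q t - re z| + `|im z|.
have YI t : 0 <= t <= l -> Y t <= I 0 t (fun s => Y s * h s).
  move=> tl; have [t0 tl'] := andP tl.
  have Yh4 : integ l (fun s => 4^-1 * (Y s * h s)) by exact: integZ.
  suff [h1 h2 h3 h4] : [/\ `|re (u t)| <= I 0 t (fun s => 4^-1 * (Y s * h s)),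
      `|im (u t)| <= I 0 t (fun s => 4^-1 * (Y s * h s)),
      `|re (du t)| <= I 0 t (fun s => 4^-1 * (Y s * h s)) &
      `|im (du t)| <= I 0 t (fun s => 4^-1 * (Y s * h s))].
    by move: h1 h2 h3 h4; rewrite !(@int_scale _ l) // /Y; lra.
  have hE s : 4^-1 * (Y s * h s) = Y s * (1 + g s) by rewrite /h /g; field.
  have nn s := (normr_ge0 (re (u s)), normr_ge0 (im (u s)),
                normr_ge0 (re (du s)), normr_ge0 (im (du s))).
  have Yr s : `|re (u s)| <= Y s /\ `|im (u s)| <= Y s.
    by rewrite /Y; case: (nn s) => -[[? ?] ?] ?; split; lra.
  have Yd s : `|re (du s)| <= Y s /\ `|im (du s)| <= Y s.
    by rewrite /Y; case: (nn s) => -[[? ?] ?] ?; split; lra.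
  have g0 s : 0 <= g s by rewrite addr_ge0.
  have Y0 s : 0 <= Y s by rewrite !addr_ge0.
  have first_order x s : x <= Y s -> x <= 4^-1 * (Y s * h s).
    by move=> /le_trans; apply; rewrite hE ler_peMr // lerDl.
  have second_order a b s : `|a| <= Y s -> `|b| <= Y s ->
      `|(q s - re z) * a| + `|im z * b| <= 4^-1 * (Y s * h s).
    move=> ha hb; rewrite hE mulrDr mulr1 !normrM.
    apply: (@le_trans _ _ (Y s * g s)); last by rewrite lerDr.
    by rewrite /g mulrDr; apply: lerD; rewrite mulrC; apply: ler_wpM2r.
  split.
  - apply: (bound _ _ _ _ ur) => //=; first by rewrite u0.
    by move=> s _; apply: first_order; have [] := Yd s.
  - apply: (bound _ _ _ _ ui) => //=; first by rewrite u0.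
    by move=> s _; apply: first_order; have [] := Yd s.
  - apply: (bound _ _ _ _ dur) => //=; first by rewrite du0.
    move=> s _; have [ha hb] := Yr s.
    exact: le_trans (ler_normD _ _) (second_order _ _ _ ha hb).
  - apply: (bound _ _ _ _ dui) => //=; first by rewrite du0.
    move=> s _; have [ha hb] := Yr s.
    exact: le_trans (ler_normB _ _) (second_order _ _ _ hb ha).
have Y0 := gronwall0 l0 Yc hi.
move=> x xl; suff Yx : Y x = 0.
  have [] : `|re (u x)| <= 0 /\ `|im (u x)| <= 0.
    by move: Yx; rewrite /Y;
      have := normr_ge0 (re (u x)); have := normr_ge0 (im (u x));
      have := normr_ge0 (re (du x)); have := normr_ge0 (im (du x)); split; lra.
  by rewrite !normr_le0 => /eqP r0 /eqP i0; apply: complex_ext.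
apply: Y0 => // t; first by move=> _; rewrite !addr_ge0.
by rewrite /h mulr_ge0 // !addr_ge0.
Qed.

(** The derivative of [u'] times the conjugate of [u] is [|u'|^2 + (q - z) |u|^2], and [q] is real,
    so its imaginary part is [- im z * |u|^2]. *)
Lemma wronskian l q z u du : 0 <= l -> integ l q -> schroedinger l q z u du ->
  im (du l * (u l)^*) - im (du 0 * (u 0)^*) =
  - im z * I 0 l (fun t => re (u t) ^+ 2 + im (u t) ^+ 2).
Proof.
move=> l0 qi /(schroedingerP _ _ _ l0 qi)[ur ui dur dui].
have c1 := ac_cont l0 ur; have c2 := ac_cont l0 ui.
have Wac := ac_axpy 1 (-1) l0 (ac_mul l0 dui ur) (ac_mul l0 dur ui).
have ll : 0 <= l <= l by rewrite l0 lexx.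
have [_ /(_ l ll)] := Wac; rewrite /= => WE.
have wE x : im (du x * (u x)^*) = 1 * (im (du x) * re (u x)) + -1 * (re (du x) * im (u x)).
  by case: (du x) => ? ?; case: (u x) => ? ? /=; ring.
rewrite !wE WE addrAC subrr add0r -(@int_scale _ l) //.
  by apply: int_eq => t _ /=; ring.
apply: cont_integ => x; apply: cvgD; rewrite expr2; apply: cvgM; first [exact: c1|exact: c2].
Qed.

Lemma schroedinger_norm0 l q z u du : 0 < l -> integ l q -> schroedinger l q z u du ->
  I 0 l (fun t => re (u t) ^+ 2 + im (u t) ^+ 2) = 0 -> forall x, 0 <= x <= l -> u x = 0.
Proof.
move=> l0 qi /(schroedingerP _ _ _ (ltW l0) qi)[ur ui _ _] I0 x xl.
have c1 := ac_cont (ltW l0) ur; have c2 := ac_cont (ltW l0) ui.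
have : re (u x) ^+ 2 + im (u x) ^+ 2 = 0.
  move: x xl; apply: cont_int0 I0 => //.
    by move=> x; apply: cvgD; rewrite expr2; apply: cvgM; first [exact: c1|exact: c2].
  by move=> x _; rewrite addr_ge0 ?sqr_ge0.
move=> /eqP; rewrite paddr_eq0 ?sqr_ge0 // !sqrf_eq0 => /andP[/eqP r0 /eqP i0].
exact: complex_ext.
Qed.

Lemma right_derivative0_lim (f : R -> R[i]) (a : R[i]) :
  (fun h : R => h^-1 * (re (f h) - re (f 0))) @ 0^'+ --> re a ->
  (fun h : R => h^-1 * (im (f h) - im (f 0))) @ 0^'+ --> im a ->
  right_derivative0 f = a.
Proof.
move=> hr hi; rewrite /right_derivative0 (cvg_lim _ hr) // (cvg_lim _ hi) //.
by case: a {hr hi}.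
Qed.

Lemma schroedinger_right_derivative l q z u du : 0 < l -> integ l q ->
  schroedinger l q z u du -> right_derivative0 u = du 0.
Proof.
move=> l0 qi /(schroedingerP _ _ _ (ltW l0) qi)[ur ui dur dui].
apply: right_derivative0_lim.
- exact: (ac_right_derivative l0 ur (ac_cont (ltW l0) dur)).
- exact: (ac_right_derivative l0 ui (ac_cont (ltW l0) dui)).
Qed.

Lemma schroedinger_left_derivative l q z u du : 0 < l -> integ l q ->
  schroedinger l q z u du -> right_derivative0 (fun x => u (l - x)) = - du l.
Proof.
move=> l0 qi /(schroedingerP _ _ _ (ltW l0) qi)[ur ui dur dui].
apply: right_derivative0_lim; rewrite subr0 ?reN ?imN.
- exact: (ac_left_derivative l0 ur (ac_cont (ltW l0) dur)).
- exact: (ac_left_derivative l0 ui (ac_cont (ltW l0) dui)).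
Qed.

End Solutions.

(** * The scattering and propagation equations *)

Section MatrixEquations.
Variables (R : realType) (n m : nat) (G : mgraph n m).
Variable Phi : 'I_(m + m) -> 'M[R[i]]_2.
Implicit Types (x : 'cV[R[i]]_((m + m) * 2)) (d : 'I_(m + m)) (l : 'I_2).
Local Notation "x # d l" := (x (mxtens_index (d, l)) ord0)
  (at level 5, d at level 4, l at level 4, format "x # d  l").

Lemma sum_mxtens (V : zmodType) (p q : nat) (f : 'I_(p * q) -> V) :
  \sum_j f j = \sum_i \sum_k f (mxtens_index (i, k)).
Proof.
rewrite pair_big /= (reindex (@mxtens_index p q)) /=.
  by apply: eq_bigr => -[].
by exists (@mxtens_unindex p q) => ? _; [exact: mxtens_indexK|exact: mxtens_unindexK].
Qed.

Lemma mul_tens1 (A : 'M[R[i]]_(m + m)) x d l :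
  ((A *t (1%:M : 'M[R[i]]_2)) *m x) # d l = \sum_d' A d d' * x # d' l.
Proof.
rewrite mxE sum_mxtens; apply: eq_bigr => d' _.
rewrite (bigD1 l) //= tensmxE mxE eqxx mulr1 big1 ?addr0 // => l' ne.
by rewrite tensmxE mxE eq_sym (negPf ne) mulr0 mul0r.
Qed.

Lemma tau_hatE x d l : (tau_hat R m *m x) # d l = x # (bar d) l.
Proof.
rewrite mul_tens1 (bigD1 (bar d)) //= mxE barK eqxx mul1r big1 ?addr0 // => d' ne.
by rewrite mxE eq_sym eq_bar (negPf ne) mul0r.
Qed.

Lemma scattering_hatE x d l :
  (scattering_hat R G *m x) # d l =
  2%:R / (degree G (src G d))%:R * (\sum_(d' | tgt G d' == src G d) x # d' l) - x # (bar d) l.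
Proof.
have <- : \sum_d' (d == bar d')%:R * x # d' l = x # (bar d) l.
  rewrite (bigD1 (bar d)) //= barK eqxx mul1r big1 ?addr0 // => d' ne.
  by rewrite -eq_bar eq_sym (negPf ne) mul0r.
rewrite mul_tens1 mulr_sumr [X in _ = X - _]big_mkcond /= -sumrB.
apply: eq_bigr => d' _; rewrite mxE; case: eqP => [e|ne].
  by rewrite -e mulrBl.
case: eqP => [e|_]; last by rewrite !mul0r subr0.
by case: ne; rewrite e src_bar.
Qed.

Lemma block_diagE x d l :
  (block_diag Phi *m x) # d l = \sum_l' Phi d l l' * x # d l'.
Proof.
rewrite mxE sum_mxtens (bigD1 d) //= [X in _ + X]big1 ?addr0 => [|d' ne].
  by apply: eq_bigr => l' _; rewrite mxE !mxtens_indexK eqxx.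
by rewrite big1 // => l' _; rewrite mxE !mxtens_indexK eq_sym (negPf ne) mul0r.
Qed.

Lemma degree_gt0 d : (0 < degree G (src G d))%N.
Proof. by apply/card_gt0P; exists d; rewrite inE eqxx. Qed.

(** Adding tau cancels the reflection term -1 of the scattering matrix; at each dart there remains a
    nonzero multiple of the sum of the entries arriving at its source. At an isolated vertex the sum
    is empty. *)
Lemma scattering_eq0P x :
  (scattering_hat R G + tau_hat R m) *m x = 0 <->
  forall v l, \sum_(d | tgt G d == v) x # d l = 0.
Proof.
have E d l : ((scattering_hat R G + tau_hat R m) *m x) # d l =
    2%:R / (degree G (src G d))%:R * (\sum_(d' | tgt G d' == src G d) x # d' l).
  by rewrite mulmxDl mxE scattering_hatE tau_hatE subrK.
have c0 d : 2%:R / (degree G (src G d))%:R != 0 :> R[i].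
  by rewrite mulf_neq0 ?invr_eq0 ?pnatr_eq0 // -lt0n degree_gt0.
split=> [h v l|h].
  have [[d dv]|nov] := pselect (exists d, src G d = v).
    have := E d l; rewrite h mxE dv => /esym/eqP.
    by rewrite mulf_eq0 -dv (negPf (c0 _)) => /eqP.
  by rewrite big_pred0 // => d; apply/eqP => dv; apply: nov; exists (bar d).
apply/matrixP => i j; rewrite ord1 [RHS]mxE -(mxtens_unindexK i).
by case: (mxtens_unindex i) => d l; rewrite E h mulr0.
Qed.

(** By the first equation the scattering matrix acts on [x] as minus tau, which swaps each dart with
    its reversal. *)
Lemma propagation_eq0P x : (scattering_hat R G + tau_hat R m) *m x = 0 ->
  (1%:M - block_diag Phi *m scattering_hat R G) *m x = 0 <->
  forall d l, x # d l = - \sum_l' Phi d l l' * x # (bar d) l'.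
Proof.
move=> St.
have E d l : ((1%:M - block_diag Phi *m scattering_hat R G) *m x) # d l =
    x # d l + \sum_l' Phi d l l' * x # (bar d) l'.
  have -> : (1%:M - block_diag Phi *m scattering_hat R G) *m x =
      x + block_diag Phi *m (tau_hat R m *m x).
    rewrite mulmxBl mul1mx -mulmxA; congr (_ + _).
    rewrite -mulmxN; congr (_ *m _); apply/eqP.
    by rewrite eq_sym -subr_eq0 opprK -mulmxDl addrC St.
  rewrite mxE block_diagE; congr (_ + _); apply: eq_bigr => l' _.
  by rewrite tau_hatE.
split=> [h d l|h].
  by have := E d l; rewrite h mxE => /esym/eqP; rewrite addr_eq0 => /eqP.
apply/matrixP => i j; rewrite ord1 [RHS]mxE -(mxtens_unindexK i).
by case: (mxtens_unindex i) => d l; rewrite E {1}h addrC subrr.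
Qed.

End MatrixEquations.

(** * Quantum-graph states *)

Section States.
Variables (R : realType) (n m : nat) (G : qgraph R n m).
Variables (Phi : 'I_(m + m) -> R[i] -> 'M[R[i]]_2) (k : R[i]).
Hypothesis hPhi : transfer_matrices G Phi.
Implicit Types (psi : gfun R n m) (d : 'I_(m + m)) (e : 'I_m).
Local Notation mu := (@lebesgue_measure R).
Local Notation im := (@complex.Im R).
Local Notation re := (@complex.Re R).
Local Notation one2 := (@Ordinal 2 1 isT).

Lemma len0 e : 0 <= len G e. Proof. exact/ltW/len_gt0. Qed.

Lemma on_dart_lshift psi e : on_dart G psi (lshift m e) = on_edge psi e.
Proof. by apply: funext => x; rewrite /on_dart forward_lshift edge_of_lshift. Qed.

Lemma on_dart_rshift psi e :
  on_dart G psi (rshift m e) = fun x => on_edge psi e (len G e - x).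
Proof. by apply: funext => x; rewrite /on_dart forward_rshift /dlen edge_of_rshift. Qed.

Lemma counterpart0 psi d :
  counterpart G psi (mxtens_index (d, ord0)) ord0 = at_vertex psi (src G d).
Proof. by rewrite mxE mxtens_indexK. Qed.

Lemma counterpart1 psi d :
  counterpart G psi (mxtens_index (d, one2)) ord0 = outgoing_derivative G psi d.
Proof. by rewrite mxE mxtens_indexK. Qed.

Definition edge_solution psi (dpsi : 'I_m -> R -> R[i]) := forall e,
  schroedinger (len G e) (pot G e) (k ^+ 2) (on_edge psi e) (dpsi e).

Lemma outgoing_lshift psi dpsi e : edge_solution psi dpsi ->
  outgoing_derivative G psi (lshift m e) = dpsi e 0.
Proof.
move=> sol; rewrite /outgoing_derivative on_dart_lshift.
exact: schroedinger_right_derivative (len_gt0 G e) (pot_integrable G e) (sol e).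
Qed.

Lemma outgoing_rshift psi dpsi e : edge_solution psi dpsi ->
  outgoing_derivative G psi (rshift m e) = - dpsi e (len G e).
Proof.
move=> sol; rewrite /outgoing_derivative on_dart_rshift.
exact: schroedinger_left_derivative (len_gt0 G e) (pot_integrable G e) (sol e).
Qed.

Lemma eigenfunction_solution psi : eigenfunction G k psi ->
  exists dpsi, edge_solution psi dpsi.
Proof. by case=> _ _ /choice[dpsi sol] _; exists dpsi. Qed.

Lemma continuous_tail psi e : continuous_at_vertices G psi ->
  at_vertex psi (src G (lshift m e)) = on_edge psi e 0.
Proof. by move=> <-; rewrite on_dart_lshift. Qed.

Lemma continuous_head psi e : continuous_at_vertices G psi ->
  at_vertex psi (src G (rshift m e)) = on_edge psi e (len G e).
Proof. by move=> <-; rewrite on_dart_rshift subr0. Qed.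

Lemma im_sum (J : finType) (P : pred J) (f : J -> R[i]) :
  im (\sum_(j | P j) f j) = \sum_(j | P j) im (f j).
Proof. by apply: (big_morph im (@imD R) erefl). Qed.

(** Self-adjointness: summed over the edges, the Wronskian boundary terms regroup by vertices, where
    [psi] has a single value and the outgoing derivatives sum to 0. What remains is [im (k ^+ 2)]
    times the squared norm of [psi]. *)
Lemma eigenvalue_real psi : eigenfunction G k psi -> im (k ^+ 2) = 0.
Proof.
move=> eig; have [dpsi sol] := eigenfunction_solution eig.
case: eig => -[e0 nz] cont _ kir.
pose N e := \int[mu]_(t in `[0, len G e]) (re (on_edge psi e t) ^+ 2 + im (on_edge psi e t) ^+ 2).
pose a d := at_vertex psi (src G d); pose b d := outgoing_derivative G psi d.
have N0 e : 0 <= N e by apply: Rintegral_ge0 => t _; rewrite addr_ge0 ?sqr_ge0.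
have sum0 : \sum_d im (b d * (a d)^*) = 0.
  rewrite -im_sum (partition_big (src G) predT) //= big1 // => v _.
  transitivity ((\sum_(d | src G d == v) b d) * (at_vertex psi v)^*).
    by rewrite mulr_suml; apply: eq_bigr => d /eqP dv; rewrite /a dv.
  by rewrite kir mul0r.
have : im (k ^+ 2) * \sum_e N e = 0.
  rewrite mulr_sumr -[RHS]sum0 big_split_ord /= -big_split; apply: eq_bigr => e _.
  have := wronskian (len0 e) (pot_integrable G e) (sol e); rewrite -/(N e).
  rewrite /a /b (continuous_tail _ cont) (continuous_head _ cont).
  rewrite (outgoing_lshift _ sol) (outgoing_rshift _ sol) !mulNr imN => /=; lra.
move/eqP; rewrite mulf_eq0 => /orP[/eqP //|].
rewrite psumr_eq0 // => /allP/(_ e0 (mem_index_enum _)) /= /eqP Ne0.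
case: nz => x; rewrite in_itv /= => xl.
exact: schroedinger_norm0 (len_gt0 G e0) (pot_integrable G e0) (sol e0) Ne0 x xl.
Qed.

Lemma col2_mul (P : 'M[R[i]]_2) (a b c d : R[i]) : P *m col2 a b = col2 c d <->
  P ord0 ord0 * a + P ord0 one2 * b = c /\ P one2 ord0 * a + P one2 one2 * b = d.
Proof.
have E i : (P *m col2 a b) i ord0 = P i ord0 * a + P i one2 * b.
  rewrite mxE !big_ord_recl big_ord0 addr0 !mxE /=.
  by rewrite (_ : lift ord0 ord0 = one2) //; apply: val_inj.
split=> [h|[h1 h2]].
  by rewrite -!E h !mxE.
apply/matrixP => i j; rewrite ord1 E mxE; case: eqP => [->|ne]; first exact: h1.
by rewrite (_ : i = one2) //; apply: val_inj; case: i ne => -[|[]] // ? [] //; apply: val_inj.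
Qed.

Lemma transfer_edge e u du : schroedinger (len G e) (pot G e) (k ^+ 2) u du ->
  Phi (lshift m e) k *m col2 (u 0) (du 0) = col2 (u (len G e)) (du (len G e)).
Proof.
have [_ + _] := hPhi (lshift m e) k.
have -> : dlen G (lshift m e) = len G e by rewrite /dlen edge_of_lshift.
have -> : dpot G (lshift m e) = pot G e.
  by apply: funext => x; rewrite /dpot forward_lshift edge_of_lshift.
by apply.
Qed.

Lemma sigma_col2 (a b : R[i]) : sigma_mx R *m col2 a b = col2 a (- b).
Proof.
rewrite /sigma_mx; apply/matrixP => i j; rewrite mul_diag_mx !mxE.
case: eqP => [->|ne]; first by rewrite expr0 mul1r.
rewrite (_ : i = one2) ?expr1 ?mulN1r //.
by apply: val_inj; case: i ne => -[|[]] // ? [] //; apply: val_inj.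
Qed.

(** This lets the equations of both orientations of an edge be stated with the one matrix of the
    forward dart. *)
Lemma transfer_reverse e (a b c d : R[i]) :
  Phi (rshift m e) k *m col2 a b = col2 c d <->
  Phi (lshift m e) k *m col2 c (- d) = col2 a (- b).
Proof.
have [U _] := hPhi (lshift m e) k; rewrite bar_lshift => ->.
have ss (w : 'cV[R[i]]_2) : sigma_mx R *m (sigma_mx R *m w) = w.
  by apply/matrixP => i j; rewrite /sigma_mx !mul_diag_mx !mxE mulrA -expr2 sqrr_sign mul1r.
rewrite -!mulmxA sigma_col2; split=> h.
  by rewrite -(sigma_col2 c d) -h ss mulKVmx.
by rewrite -h mulKmx // sigma_col2 opprK.
Qed.

End States.

(** * Vanishing at the vertices and the form of a state on one edge *)

Section TopologicalStates.
Variables (R : realType) (n m : nat) (G : qgraph R n m).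
Variables (Phi : 'I_(m + m) -> R[i] -> 'M[R[i]]_2) (k : R[i]).
Hypothesis hPhi : transfer_matrices G Phi.
Implicit Types (psi : gfun R n m) (d : 'I_(m + m)) (e : 'I_m).
Local Notation im := (@complex.Im R).
Local Notation re := (@complex.Re R).
Local Notation one2 := (@Ordinal 2 1 isT).

Lemma sum_tgt (b : 'I_(m + m) -> R[i]) v :
  \sum_(d | tgt G d == v) b d = \sum_(d | src G d == v) b (bar d).
Proof.
rewrite (reindex (@bar m)) /=; last by exists (@bar m) => ? _; exact: barK.
by apply: eq_bigl => d; rewrite tgt_bar.
Qed.

Lemma topological_stateP psi : topological_state G Phi k psi <->
  [/\ eigenfunction G k psi,
      forall v, \sum_(d | src G d == v) at_vertex psi (tgt G d) = 0,
      forall v, \sum_(d | src G d == v) outgoing_derivative G psi (bar d) = 0 &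
      forall d, Phi d k *m col2 (at_vertex psi (tgt G d)) (outgoing_derivative G psi (bar d)) =
        col2 (- at_vertex psi (src G d)) (- outgoing_derivative G psi d)].
Proof.
have two (l : 'I_2) : l = ord0 \/ l = one2.
  by case: l => -[|[]] // h; [left|right]; apply: val_inj.
have one2E : lift ord0 ord0 = one2 by apply: val_inj.
split.
  case=> eig /[dup] St /scattering_eq0P St' /(propagation_eq0P _ St) Pr; split => //.
  - move=> v; rewrite -[RHS](St' v ord0) sum_tgt; apply: eq_bigr => d _.
    by rewrite counterpart0.
  - move=> v; rewrite -[RHS](St' v one2) sum_tgt; apply: eq_bigr => d _.
    by rewrite counterpart1.
  - move=> d; apply/col2_mul; split.
      have := Pr d ord0; rewrite !big_ord_recl big_ord0 addr0 one2E.
      by rewrite !counterpart0 !counterpart1 src_bar => ->; rewrite opprK.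
    have := Pr d one2; rewrite !big_ord_recl big_ord0 addr0 one2E.
    by rewrite !counterpart0 !counterpart1 src_bar => ->; rewrite opprK.
case=> eig sum0 sum1 Pr.
have St : (scattering_hat R G + tau_hat R m) *m counterpart G psi = 0.
  apply/scattering_eq0P => v l; rewrite sum_tgt; case: (two l) => ->.
    by rewrite -[RHS](sum0 v); apply: eq_bigr => d _; rewrite counterpart0.
  by rewrite -[RHS](sum1 v); apply: eq_bigr => d _; rewrite counterpart1.
split => //; apply/(propagation_eq0P _ St) => d l.
rewrite !big_ord_recl big_ord0 addr0 one2E !counterpart0 !counterpart1 src_bar.
have /col2_mul[h0 h1] := Pr d.
by case: (two l) => ->; rewrite ?counterpart0 ?counterpart1 ?h0 ?h1 opprK.
Qed.

Section OneState.
Variables (psi : gfun R n m) (dpsi : 'I_m -> R -> R[i]).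
Hypothesis top : topological_state G Phi k psi.
Hypothesis sol : edge_solution G k psi dpsi.

(** Four facts about one matrix: transfer of [psi], transfer of its conjugate (a solution too, as
    [k ^+ 2] and the potential are real), and the propagation equations of the two darts of [e], the
    backward one turned round. *)
Lemma topological_edge e :
  let P := Phi (lshift m e) k in
  let A := at_vertex psi (src G (lshift m e)) in
  let C := at_vertex psi (src G (rshift m e)) in
  [/\ P *m col2 A (dpsi e 0) = col2 C (dpsi e (len G e)),
      P *m col2 A^* (dpsi e 0)^* = col2 C^* (dpsi e (len G e))^*,
      P *m col2 C (- dpsi e (len G e)) = col2 (- A) (- dpsi e 0) &
      P *m col2 C (dpsi e (len G e)) = col2 (- A) (dpsi e 0)].
Proof.
move=> P A C.
have [eig _ _ Pr] := (topological_stateP psi).1 top.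
have cont : continuous_at_vertices G psi by case: eig.
have AE : A = on_edge psi e 0 by exact: continuous_tail.
have CE : C = on_edge psi e (len G e) by exact: continuous_head.
split.
- by rewrite AE CE; exact: (transfer_edge hPhi (sol e)).
- rewrite AE CE; apply: (transfer_edge hPhi (e := e) (u := fun x => (on_edge psi e x)^*)
    (du := fun x => (dpsi e x)^*)).
  exact: schroedinger_conj (len0 G e) (pot_integrable G e) (eigenvalue_real eig) (sol e).
- have := Pr (lshift m e); rewrite -src_bar bar_lshift.
  by rewrite (outgoing_lshift _ sol) (outgoing_rshift _ sol).
- have := Pr (rshift m e); rewrite -src_bar bar_rshift -/A -/C.
  rewrite (outgoing_lshift _ sol) (outgoing_rshift _ sol) opprK.
  move/(transfer_reverse k hPhi)/col2_mul => [h1 h2]; apply/col2_mul.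
  by split; rewrite -[LHS]opprK opprD -!mulrN ?h1 ?h2 ?opprK.
Qed.

(** The last four equations give [p01 * E = 0], [p11 * E = B] and [p00 * C = - A], hence [p01 = 0]
    or [B = 0]. The first two then say that [p00] maps [A] to [C] and the conjugate of [A] to that
    of [C]. For nonzero [A], [p00] would be real with square -1. *)
Lemma topological_scalar (p00 p01 p10 p11 A B C E : R[i]) :
  p00 * A + p01 * B = C -> p00 * A^* + p01 * B^* = C^* ->
  p00 * C + p01 * - E = - A -> p00 * C + p01 * E = - A ->
  p10 * C + p11 * - E = - B -> p10 * C + p11 * E = B ->
  A = 0 /\ C = 0.
Proof.
move=> h1 h2 h3 h4 h5 h6.
have two0 (x : R[i]) : x + x = 0 -> x = 0.
  by move=> /eqP; rewrite -mulr2n mulrn_eq0 => /eqP.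
have p01E : p01 * E = 0.
  by apply: two0; move: h3 => /eqP; rewrite -h4 mulrN => /eqP/addrI; move=> e; rewrite -{1}e addNr.
have p11E : p11 * E = B.
  have p10C : p10 * C = 0.
    by apply: two0; have := congr2 +%R h5 h6; rewrite addNr => <-; ring.
  by rewrite -h6 p10C add0r.
have {h4}h4 : p00 * C = - A by rewrite -h4 p01E addr0.
have pB : p01 = 0 \/ B = 0.
  move: p01E => /eqP; rewrite mulf_eq0 => /orP[/eqP ->|/eqP E0]; first by left.
  by right; rewrite -p11E E0 mulr0.
have {}h1 : p00 * A = C by case: pB h1 => ->; rewrite ?mul0r ?mulr0 addr0.
have {}h2 : p00 * A^* = C^*.
  by case: pB h2 => ->; rewrite ?mul0r ?rmorph0 ?mulr0 addr0.
suff A0 : A = 0 by rewrite -h1 A0 mulr0.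
apply/eqP/negPn/negP => nA.
have sq : p00 * p00 = -1.
  by apply: (mulIf nA); rewrite -mulrA h1 h4 mulN1r.
have pc : p00^* = p00.
  by apply: (mulIf nA); rewrite h1; have := congr1 conjc h2; rewrite rmorphM /= !conjcK.
have ip : im p00 = 0.
  by have := congr1 im pc; case: p00 {sq pc h1 h2 h4 h3 h5 h6} => a b /=; lra.
have := congr1 re sq; rewrite reM ip mulr0 subr0 /=.
have := sqr_ge0 (re p00); rewrite expr2; lra.
Qed.

Lemma topological_edge0 e :
  at_vertex psi (src G (lshift m e)) = 0 /\ at_vertex psi (src G (rshift m e)) = 0.
Proof.
have [/col2_mul[h1 _] /col2_mul[h2 _] /col2_mul[h3 h5] /col2_mul[h4 h6]] :=
  topological_edge e.
exact: topological_scalar h1 h2 h3 h4 h5 h6.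
Qed.

Lemma topological_src0 d : at_vertex psi (src G d) = 0.
Proof. by case: (dartP d) => e; have [] := topological_edge0 e. Qed.

Lemma topological_ends e : on_edge psi e 0 = 0 /\ on_edge psi e (len G e) = 0.
Proof.
have [eig _ _ _] := (topological_stateP psi).1 top.
have cont : continuous_at_vertices G psi by case: eig.
by rewrite -(continuous_tail _ cont) -(continuous_head _ cont) !topological_src0.
Qed.

Lemma topological_edge1 e :
  let p11 := Phi (lshift m e) k one2 one2 in
  p11 * dpsi e 0 = dpsi e (len G e) /\ p11 * dpsi e (len G e) = dpsi e 0.
Proof.
have [/col2_mul[_ h1] _ _ /col2_mul[_ h2]] := topological_edge e.
by split; [rewrite -h1|rewrite -h2]; rewrite !topological_src0 mulr0 add0r.
Qed.

End OneState.

(* The transfer matrix of [e] then maps (0, 1) to (0, s). *)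
Definition unit_solution e (s : R[i]) (u du : R -> R[i]) :=
  [/\ schroedinger (len G e) (pot G e) (k ^+ 2) u du, u 0 = 0 /\ du 0 = 1,
      u (len G e) = 0 /\ du (len G e) = s & s = 1 \/ s = -1].

(** Multiplication by [p11] exchanges the derivatives at the two ends, so their squares agree;
    dividing by the one at 0 normalizes the solution. *)
Lemma topological_unit psi dpsi e : topological_state G Phi k psi ->
  edge_solution G k psi dpsi -> dpsi e 0 != 0 -> exists s u du, unit_solution e s u du.
Proof.
move=> top sol nB; have [u0 ul] := topological_ends top sol e.
have [h1 h2] := topological_edge1 top sol e.
exists (dpsi e (len G e) / dpsi e 0), (fun x => (dpsi e 0)^-1 * on_edge psi e x),
  (fun x => (dpsi e 0)^-1 * dpsi e x); split.
- exact: schroedinger_scale (len0 G e) (pot_integrable G e) (sol e).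
- by rewrite u0 mulr0 mulVf.
- by rewrite ul mulr0 mulrC.
- have : (dpsi e (len G e) / dpsi e 0) ^+ 2 = 1.
    rewrite expr_div_n; apply: (mulIf (expf_neq0 2 nB)); rewrite divfK ?expf_neq0 // mul1r.
    by rewrite !expr2 -{2}h1 mulrCA mulrA h2.
  move/eqP; rewrite sqrf_eq1 => /orP[] /eqP; auto.
Qed.

Lemma topological_coord psi dpsi e s u du : topological_state G Phi k psi ->
  edge_solution G k psi dpsi -> unit_solution e s u du ->
  (forall x, 0 <= x <= len G e -> on_edge psi e x = dpsi e 0 * u x) /\
  dpsi e (len G e) = s * dpsi e 0.
Proof.
move=> top sol [us [u0 du0] [ul dul] _]; split.
  move=> x xl; apply/eqP; rewrite eq_sym -subr_eq0 -oppr_eq0 opprB addrC -mulNr; apply/eqP.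
  have := schroedinger_axpy (- dpsi e 0) (len0 G e) (pot_integrable G e) us (sol e).
  move=> /(schroedinger_unique (len0 G e) (pot_integrable G e)); apply => //.
    by rewrite u0 mulr0 add0r; case: (topological_ends top sol e).
  by rewrite du0 mulr1 addNr.
have [h1 _] := topological_edge1 top sol e.
have /col2_mul[_] := transfer_edge hPhi us.
by rewrite u0 du0 dul mulr0 add0r mulr1 => <-.
Qed.

End TopologicalStates.

(** * States and balanced vectors *)

(** The choice depends on [G] and [k] alone, so that all states are described in the same
    coordinates. *)
Lemma unit_solution_choice (R : realType) (n m : nat) (G : qgraph R n m) (k : R[i]) :
  exists (D : {set 'I_m}) (eps : 'I_m -> R[i]) (u du : 'I_m -> R -> R[i]),
    (forall e, e \in D -> unit_solution G k e (eps e) (u e) (du e)) /\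
    (forall e s v dv, unit_solution G k e s v dv -> e \in D).
Proof.
have ex e : exists t : R[i] * (R -> R[i]) * (R -> R[i]),
    (exists s v dv, unit_solution G k e s v dv) -> unit_solution G k e t.1.1 t.1.2 t.2.
  have [[s [v [dv us]]]|no] := pselect (exists s v dv, unit_solution G k e s v dv).
    by exists (s, v, dv).
  by exists (0, (fun=> 0), (fun=> 0)) => /no.
have [t tP] := choice ex.
exists [set e | `[< exists s v dv, unit_solution G k e s v dv >]]%SET.
exists (fun e => (t e).1.1), (fun e => (t e).1.2), (fun e => (t e).2); split.
  by move=> e; rewrite inE => /asboolP; exact: tP.
by move=> e s v dv us; rewrite inE; apply/asboolP; exists s, v, dv.
Qed.

Section Coordinates.
Variables (R : realType) (n m : nat) (G : qgraph R n m).
Variables (Phi : 'I_(m + m) -> R[i] -> 'M[R[i]]_2) (k : R[i]).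
Hypothesis hPhi : transfer_matrices G Phi.
Variables (D : {set 'I_m}) (eps : 'I_m -> R[i]) (u du : 'I_m -> R -> R[i]).
Hypothesis uD : forall e, e \in D -> unit_solution G k e (eps e) (u e) (du e).
Hypothesis Dmax : forall e s v dv, unit_solution G k e s v dv -> e \in D.
Implicit Types (psi : gfun R n m) (d : 'I_(m + m)) (e : 'I_m) (b : 'I_(m + m) -> R[i]).

Lemma eps_sign e : e \in D -> eps e = 1 \/ eps e = -1.
Proof. by case/uD. Qed.

Lemma eps_sqr e : e \in D -> eps e * eps e = 1.
Proof. by case/eps_sign => ->; ring. Qed.

(** On an edge outside [D] the derivative at 0 is zero, since otherwise it would normalize to a unit
    solution; there [psi] vanishes by uniqueness. The sum weighted by [eps] is minus the sum of the
    derivatives at the far ends. *)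
Lemma topological_vector psi : topological_state G Phi k psi ->
  balanced G eps D (outgoing_derivative G psi) /\
  forall e x, 0 <= x <= len G e ->
    on_edge psi e x = outgoing_derivative G psi (lshift m e) * u e x.
Proof.
move=> top; have [eig _ sum1 _] := (topological_stateP G Phi k psi).1 top.
have [dpsi sol] := eigenfunction_solution eig.
have kir : kirchhoff G psi by case: eig.
have outD e : e \notin D -> dpsi e 0 = 0 /\ dpsi e (len G e) = 0.
  move=> eD; have d0 : dpsi e 0 = 0.
    apply/eqP/negPn/negP => nB.
    have [s [v [dv us]]] := topological_unit hPhi top sol nB.
    by rewrite (Dmax us) in eD.
  by have [<- _] := topological_edge1 hPhi top sol e; rewrite d0 mulr0.
have barE d : outgoing_derivative G psi (bar d) =
    - eps (edge_of d) * outgoing_derivative G psi d.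
  case: (dartP d) => e; rewrite ?bar_lshift ?bar_rshift ?edge_of_lshift ?edge_of_rshift;
    rewrite (outgoing_lshift _ sol) (outgoing_rshift _ sol);
    (have [eD|eD] := boolP (e \in D); last by have [-> ->] := outD _ eD; rewrite ?oppr0 mulr0);
    have [_ ->] := topological_coord hPhi top sol (uD eD).
    by rewrite mulNr.
  by rewrite mulrNN mulrA eps_sqr // mul1r.
split; first split => //.
- by move=> d; case: (dartP d) => e; rewrite ?edge_of_lshift ?edge_of_rshift => /outD[d0 dl];
    rewrite ?(outgoing_lshift _ sol) ?(outgoing_rshift _ sol) ?d0 ?dl ?oppr0.
- move=> v; apply: oppr_inj; rewrite oppr0 -sumrN -[RHS](sum1 v).
  by apply: eq_bigr => d _; rewrite barE mulNr.
- move=> e x xl; rewrite (outgoing_lshift _ sol).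
  have [eD|eD] := boolP (e \in D).
    by have [-> //] := topological_coord hPhi top sol (uD eD).
  have [d0 _] := outD _ eD; rewrite d0 mul0r.
  have [u0 _] := topological_ends hPhi top sol e.
  exact: schroedinger_unique (len0 G e) (pot_integrable G e) (sol e) u0 d0 x xl.
Qed.

Definition state_of b : gfun R n m := GFun (fun=> 0) (fun e x => b (lshift m e) * u e x).

Lemma unit_solution_neq0 e : e \in D -> exists2 x, 0 <= x <= len G e & u e x != 0.
Proof.
case/uD=> us [u0 du0] _ _; apply: contrapT => no.
have z x : 0 <= x <= len G e -> u e x = 0.
  by move=> xl; apply/eqP/negPn/negP => ux; apply: no; exists x.
have := schroedinger_right_derivative (len_gt0 G e) (pot_integrable G e) us.
rewrite du0 (right_derivative0_lim (a := 0)).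
- by move=> /eqP; rewrite eq_sym oner_eq0.
- apply: cvg_near_cst; near=> h; rewrite !z ?subrr ?mulr0 ?lexx ?len0 //.
  apply/andP; split => //; near: h; exact: nbhs_right_le (len_gt0 G e).
- apply: cvg_near_cst; near=> h; rewrite !z ?subrr ?mulr0 ?lexx ?len0 //.
  apply/andP; split => //; near: h; exact: nbhs_right_le (len_gt0 G e).
Unshelve. all: by end_near. Qed.

Section StateOf.
Variable b : 'I_(m + m) -> R[i].
Hypothesis bal : balanced G eps D b.

Lemma state_of_solution : edge_solution G k (state_of b) (fun e x => b (lshift m e) * du e x).
Proof.
move=> e; have [eD|eD] := boolP (e \in D).
  have [us _ _ _] := uD eD.
  exact: schroedinger_scale (len0 G e) (pot_integrable G e) us.
have b0 : b (lshift m e) = 0 by case: bal => h _ _ _; apply: h; rewrite edge_of_lshift.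
have := schroedinger0 (k ^+ 2) (len0 G e) (pot_integrable G e).
by congr schroedinger; apply: funext => x /=; rewrite b0 mul0r.
Qed.

Lemma state_of_outgoing d : outgoing_derivative G (state_of b) d = b d.
Proof.
have [bD bbar _ _] := bal.
case: (dartP d) => e.
  rewrite (outgoing_lshift _ state_of_solution); have [eD|eD] := boolP (e \in D).
    by have [_ [_ ->] _ _] := uD eD; rewrite mulr1.
  by rewrite bD ?edge_of_lshift // mul0r.
rewrite (outgoing_rshift _ state_of_solution) -bar_lshift bbar edge_of_lshift.
have [eD|eD] := boolP (e \in D).
  by have [_ _ [_ ->] _] := uD eD; rewrite mulNr mulrC.
by rewrite bD ?edge_of_lshift // mul0r mulr0 oppr0.
Qed.

Lemma state_of_vanishes e : vanishes_on G (state_of b) e <-> b (lshift m e) = 0.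
Proof.
split=> [van|b0 x _]; last by rewrite /= b0 mul0r.
have [eD|eD] := boolP (e \in D); last first.
  by case: bal => h _ _ _; apply: h; rewrite edge_of_lshift.
have [x xl ux] := unit_solution_neq0 eD.
have := van x; rewrite in_itv /= xl => /(_ isT)/eqP.
by rewrite mulf_eq0 (negPf ux) orbF => /eqP.
Qed.

Lemma balanced_lshift e d : edge_of d = e -> b (lshift m e) = 0 -> b d = 0.
Proof.
have [_ bbar _ _] := bal.
case: (dartP d) => e'; rewrite ?edge_of_lshift ?edge_of_rshift => -> // b0.
by rewrite -bar_lshift bbar b0 mulr0.
Qed.

Lemma state_of_topological : (exists d, b d != 0) -> topological_state G Phi k (state_of b).
Proof.
move=> [d0 bd0]; have [bD bbar bsum besum] := bal.
have sol := state_of_solution.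
have ends e : b (lshift m e) * u e 0 = 0 /\ b (lshift m e) * u e (len G e) = 0.
  have [eD|eD] := boolP (e \in D).
    by have [_ [-> _] [-> _] _] := uD eD; rewrite mulr0.
  by rewrite bD ?edge_of_lshift // !mul0r.
have besum' v : \sum_(d | src G d == v) b (bar d) = 0.
  rewrite -[RHS]oppr0 -[in RHS](besum v) -sumrN; apply: eq_bigr => d _.
  by rewrite bbar mulNr.
apply/topological_stateP; split.
- split.
  + exists (edge_of d0) => /state_of_vanishes b0.
    by rewrite (balanced_lshift erefl b0) eqxx in bd0.
  + move=> d; case: (dartP d) => e; rewrite ?on_dart_lshift ?on_dart_rshift ?subr0 /=;
    by have [] := ends e.
  + by move=> e; exists (fun x => b (lshift m e) * du e x); exact: sol.
  + by move=> v; rewrite -[RHS](bsum v); apply: eq_bigr => d _; exact: state_of_outgoing.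
- by move=> v; rewrite big1.
- by move=> v; rewrite -[RHS](besum' v); apply: eq_bigr => d _; exact: state_of_outgoing.
(* On [D] the transfer matrix maps (0, 1) to (0, [eps e]), so both propagation equations of [e]
   reduce to the relation between [b] at its two darts and to [eps e] having square 1. *)
- have fwd e : Phi (lshift m e) k *m col2 0 (b (rshift m e)) = col2 0 (- b (lshift m e)) /\
      Phi (lshift m e) k *m col2 0 (- b (lshift m e)) = col2 0 (b (rshift m e)).
    have rE : b (rshift m e) = - eps e * b (lshift m e).
      by rewrite -bar_lshift bbar edge_of_lshift.
    have [eD|eD] := boolP (e \in D); last first.
      rewrite rE bD ?edge_of_lshift // mulr0 oppr0.
      by split; apply/col2_mul; rewrite !mulr0 addr0.
    have [us [u0 du0] [ul dul] _] := uD eD.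
    have /col2_mul := transfer_edge hPhi us; rewrite u0 du0 ul dul !mulr0 !mulr1 !add0r.
    case=> p01 p11; split; apply/col2_mul; rewrite !mulr0 !add0r p01 p11 !mul0r; split => //.
      by rewrite rE mulrA mulrN eps_sqr // mulN1r.
    by rewrite rE mulrN mulNr.
  move=> d; rewrite /= !state_of_outgoing oppr0; case: (dartP d) => e.
    by rewrite bar_lshift; case: (fwd e).
  rewrite bar_rshift; apply/(transfer_reverse k hPhi); rewrite opprK.
  by case: (fwd e).
Qed.

End StateOf.

Lemma sum_on_edge N (c : 'I_N -> R[i]) (phi : 'I_N -> gfun R n m)
    (b : 'I_N -> 'I_(m + m) -> R[i]) e x :
  (forall i, on_edge (phi i) e x = b i (lshift m e) * u e x) ->
  \sum_i c i * on_edge (phi i) e x = (\sum_i c i * b i (lshift m e)) * u e x.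
Proof. by move=> h; rewrite mulr_suml; apply: eq_bigr => i _; rewrite h mulrA. Qed.

End Coordinates.

(** * From edge sets to the whole graph; linear dependence *)

Section Graph.
Variables (n m : nat) (G : mgraph n m).

Lemma connected_in_setT : connected_graph G -> connected_in G [set: 'I_m].
Proof.
move=> [_ con] u v; have /connectP[p] := con u v.
have all_in w : walk_in [set: 'I_m] w by apply/allP => d _; rewrite inE.
elim: p u => [|y p IH] u /=; first by move=> _ ->; exists [::] => /=.
move=> /andP[/existsP[d /andP[/eqP du /eqP dy]] pp] vE.
have [q qW _] := IH y pp vE.
by exists (d :: q); [rewrite /= du eqxx dy|exact: all_in].
Qed.

Lemma connected_in_src A : connected_in G A -> 'I_(m + m) -> forall v, exists d, src G d = v.
Proof.
move=> con d0 v; have [[|d p]] := con v (src G d0).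
  by move=> /= /eqP -> _; exists d0.
by move=> /= /andP[/eqP dv _] _; exists d.
Qed.

Lemma generates_in_pi1 v0 N (g : 'I_N -> seq 'I_(m + m)) gs :
  (forall x, x \in gs -> exists j, g j = x) ->
  (forall j, is_walk G v0 (g j) v0) ->
  generates_in G [set: 'I_m] v0 gs -> generates_pi1 G v0 g.
Proof.
move=> gE gW gen; split=> // p pW.
have [|ws wsP h] := gen p pW; first by apply/allP => d _; rewrite inE.
suff [w wE] : exists w : seq ('I_N * bool), word_value ws =
    flatten [seq if jb.2 then g jb.1 else rev_walk (g jb.1) | jb <- w].
  by exists w; rewrite -wE.
elim: ws wsP {h} => [|[x bb] ws IH] /=; first by exists [::].
move=> /andP[/gE[j gj] /IH[w wE]]; exists ((j, bb) :: w).
by rewrite /word_value /= gj; congr (_ ++ _).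
Qed.

End Graph.

Lemma span_dependent (F : fieldType) (T : Type) N M (f : 'I_N -> T -> F) (g : 'I_M -> T -> F)
    (c : 'I_N -> 'I_M -> F) :
  (forall i t, f i t = \sum_j c i j * g j t) -> (M < N)%N ->
  exists2 a : 'I_N -> F, (forall t, \sum_i a i * f i t = 0) & exists i, a i != 0.
Proof.
move=> fE MN; pose A : 'M[F]_(N, M) := \matrix_(i, j) c i j.
have : kermx A != 0.
  by rewrite -mxrank_eq0 mxrank_ker subn_eq0 -ltnNge; apply: leq_ltn_trans MN; exact: rank_leq_col.
move/matrix0Pn => [i0 [j0 nz]]; exists (fun i => kermx A i0 i); last by exists j0.
move=> t; have E j : \sum_i kermx A i0 i * c i j = 0.
  have /matrixP/(_ i0 j) := mulmx_ker A; rewrite !mxE => {2}<-.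
  by apply: eq_bigr => i _; rewrite [A i j]mxE.
under eq_bigr do rewrite fE mulr_sumr.
rewrite exchange_big big1 //= => j _.
by under eq_bigr do rewrite mulrA; rewrite -mulr_suml E mul0r.
Qed.

Theorem theorem3p1 (R : realType) (n m : nat) (G : qgraph R n m)
    (hG : connected_graph G)
    (Phi : 'I_(m + m) -> R[i] -> 'M[R[i]]_2) (hPhi : transfer_matrices G Phi)
    (k : R[i]) (psi : gfun R n m) (hpsi : topological_state G Phi k psi)
    (x : 'cV[R[i]]_((m + m) * 2)) (hx : x = counterpart G psi) :
  [/\ forall l : 'I_2, delta_t_star R G *m component l x = 0,
      [/\ forall d, component ord0 x d ord0 = 0,
          forall v, at_vertex psi v = 0 &
          forall d, degree G (tgt G d) = 1%N ->
            vanishes_on G psi (edge_of d)] &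
      [/\ forall (N : nat) (phi : 'I_N -> gfun R n m),
            (forall i, topological_state G Phi k (phi i)) ->
            linearly_independent G phi -> (N <= betti1 G)%N,
          exists (N : nat) (phi : 'I_N -> gfun R n m)
                 (C : 'I_(betti1 G) -> seq 'I_(m + m))
                 (j : 'I_N -> 'I_(betti1 G)),
            cycle_basis Phi k phi C j &
          forall (N : nat) (phi : 'I_N -> gfun R n m)
                 (C : 'I_(betti1 G) -> seq 'I_(m + m))
                 (j : 'I_N -> 'I_(betti1 G)),
            cycle_basis Phi k phi C j ->
            forall i e, e \in map (@edge_of m) (C (j i)) ->
              ~ vanishes_on G (phi i) e ->
              dirichlet_eigenvalue G e (k ^+ 2)]].
Proof.
have [D [eps [u [du [uD Dmax]]]]] := unit_solution_choice G k.
have conT := connected_in_setT hG.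
have coords phi (top : topological_state G Phi k phi) := topological_vector hPhi uD Dmax top.
have ends phi e : topological_state G Phi k phi ->
    exists2 dphi, schroedinger (len G e) (pot G e) (k ^+ 2) (on_edge phi e) dphi &
      on_edge phi e 0 = 0 /\ on_edge phi e (len G e) = 0.
  move=> top; have [eig _ _] := top; have [dphi sol] := eigenfunction_solution eig.
  by exists (dphi e); [exact: sol|exact: (topological_ends hPhi top sol)].
have eig : eigenfunction G k psi by case: hpsi.
have [dpsi sol] := eigenfunction_solution eig.
have [e0 nz0] : exists e, ~ vanishes_on G psi e by case: eig.
(* A state is nonzero on some edge, so no vertex of the connected graph is isolated and every vertex
   is the source of a dart. *)
have onto := connected_in_src conT (lshift m e0).
have vertex0 v : at_vertex psi v = 0.
  by have [d <-] := onto v; exact: (topological_src0 hPhi hpsi sol).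
have n0 : (0 < n)%N by case: hG.
have nm : (n <= m.+1)%N.
  by have := connected_in_card R conT; rewrite cardsT card_ord.
pose beta := betti1 G.
have cT : #|[set: 'I_m]%SET|.+1 = (n + beta)%N.
  by rewrite cardsT card_ord /beta /betti1 addn1 subnKC.
have [L [vs [sL LP gen [svs vsP] [span indep]]]] :=
  cycle_system (Ordinal n0) (eps_sign uD) conT cT.
rewrite finset.setTI in vsP span.
pose N0 := size vs; pose b (i : 'I_N0) := nth (fun=> 0) vs i.
have bbal i : balanced G eps D (b i) by have [] := vsP i (ltn_ord i).
have spanI phi : topological_state G Phi k phi -> exists c : 'I_N0 -> R[i],
    forall d, outgoing_derivative G phi d = \sum_i c i * b i d.
  by move=> /coords[bal _]; have [c cE] := span _ bal; exists (fun i => c i).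
split.
- move=> l; have [St _] : (scattering_hat R G + tau_hat R m) *m x = 0 /\ True.
    by rewrite hx; case: hpsi.
  apply/matrixP => v j; rewrite ord1 !mxE.
  have /scattering_eq0P/(_ v l) := St; rewrite big_mkcond /= => {2}<-.
  by apply: eq_bigr => d _; rewrite !mxE; case: eqP => _; rewrite ?mul1r ?mul0r.
- split=> //; first by move=> d; rewrite mxE hx counterpart0 vertex0.
  move=> d deg1 y; rewrite in_itv /= => yl.
  have [[_ bbar bsum _] onE] := coords _ hpsi.
  (* At a vertex of degree one Kirchhoff's sum has a single term. *)
  have b0 : outgoing_derivative G psi (bar d) = 0.
    have := bsum (tgt G d); rewrite (bigD1 (bar d)) //= big1 ?addr0 // => d' /andP[d't ne].
    have /cards1P[z zE] : #|[set d' | src G d' == tgt G d]%SET| == 1%N by apply/eqP.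
    have inz d2 : src G d2 == tgt G d -> d2 = z.
      by move=> h; apply/set1P; rewrite -zE inE.
    have dz := inz _ d't; have bz : bar d = z by apply: inz; rewrite src_bar.
    by rewrite dz bz eqxx in ne.
  rewrite onE //.
  suff -> : outgoing_derivative G psi (lshift m (edge_of d)) = 0 by rewrite mul0r.
  case: (dartP d) b0 => e; rewrite ?bar_lshift ?bar_rshift ?edge_of_lshift ?edge_of_rshift //.
  by rewrite -(bar_rshift e) bbar => ->; rewrite mulr0.
split.
- move=> N phi top lin; rewrite leqNgt; apply/negP => N_lt.
  have [c cE] := choice (fun i => spanI (phi i) (top i)).
  (* A linear relation between the coordinate vectors is one between the states themselves. *)
  have [a a0 [i ai]] := span_dependent cE (leq_ltn_trans svs N_lt).
  suff : a i = 0 by move/eqP; rewrite (negPf ai).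
  apply: lin => e y; rewrite in_itv /= => yl.
  rewrite (@sum_on_edge _ _ _ u _ _ _ (fun i => outgoing_derivative G (phi i))).
    by rewrite a0 mul0r.
  by move=> i'; have [_ ->] := coords _ (top i').
- pose C (j : 'I_beta) := (nth ([::], [::]) L j).2.
  have LPj (j : 'I_beta) := LP _ (mem_nth ([::], [::]) (leq_trans (ltn_ord j) (eq_leq (esym sL)))).
  have bE i d : (b i d != 0) = (edge_of d \in map (@edge_of m) (C (widen_ord svs i))).
    by have [_ ->] := vsP i (ltn_ord i).
  have bn0 i : exists d, b i d != 0.
    have [[Cn _] _] := LPj (widen_ord svs i).
    move: (bE i) Cn; rewrite /C; case: (nth _ L _).2 => // d t tE _.
    by exists d; rewrite tE /= inE eqxx.
  (* The basis states belong to the first [N0] cycles of the list. *)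
  exists N0, (fun i => state_of n u (b i)), C, (widen_ord svs); split.
  + split.
    * by move=> i; exact: (state_of_topological hPhi uD (bbal i) (bn0 i)).
    (* [indep] takes coefficients indexed by [nat], so [c] is extended by 0. *)
    * move=> c c0 i; pose c' j := if insub j is Some i' then c i' else 0.
      have c'E (i' : 'I_N0) : c' i' = c i' by rewrite /c' valK.
      rewrite -c'E; apply: indep => // d.
      under eq_bigr do rewrite c'E.
      (* The combination of the states only shows the forward darts; being balanced settles their
         reversals. *)
      have bal : balanced G eps D (fun d => \sum_(i < N0) c i * b i d).
        split.
        - by move=> d' d'D; rewrite big1 // => i' _; have [-> // _ _ _] := bbal i'; rewrite mulr0.
        - move=> d'; rewrite mulr_sumr; apply: eq_bigr => i' _.
          by have [_ -> _ _] := bbal i'; ring.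
        - move=> v; rewrite exchange_big big1 //= => i' _.
          by have [_ _ h _] := bbal i'; rewrite -mulr_sumr h mulr0.
        - move=> v; under eq_bigr do rewrite mulr_sumr.
          rewrite exchange_big big1 //= => i' _; have [_ _ _ h] := bbal i'.
          by under eq_bigr do rewrite mulrCA; rewrite -mulr_sumr h mulr0.
      apply: (balanced_lshift bal (e := edge_of d)) => //.
      apply/(state_of_vanishes uD bal) => y yl.
      rewrite -[RHS](c0 (edge_of d) y yl) /= mulr_suml.
      by apply: eq_bigr => i' _; rewrite mulrA.
    * move=> phi top; have [c cE] := spanI _ top; exists c => e y; rewrite in_itv /= => yl.
      have [_ ->] := coords _ top; rewrite // cE mulr_suml.
      by apply: eq_bigr => i _; rewrite mulrA.
  + split; first by move=> j; have [] := LPj j.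
    have /choice[w wP] j : exists w, is_walk G (Ordinal n0) (nth ([::], [::]) L (j : 'I_beta)).1 w /\
        is_walk G w (C j) w.
      by have [_ ] := LPj j.
    exists (Ordinal n0), w, (fun j => (nth ([::], [::]) L j).1); split.
    * by move=> j; have [] := wP j.
    * by move=> j; have [] := wP j.
    * apply: generates_in_pi1 gen.
      - move=> y /mapP[p pL ->].
        have /(nthP ([::], [::])) [i iL <-] := pL; rewrite sL in iL.
        by exists (Ordinal iL).
      - move=> j; have [qW cW] := wP j.
        by rewrite (is_walk_cat _ _ qW) (is_walk_cat _ _ cW); exact: is_walk_rev.
  + by move=> i i' /(congr1 val) /= h; apply: val_inj.
  + move=> i e; rewrite -[e in e \in _]edge_of_lshift -bE.
    split=> [nv|nz /(state_of_vanishes uD (bbal i)) b0]; last by rewrite b0 eqxx in nz.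
    by apply/eqP => b0; apply: nv; apply/(state_of_vanishes uD (bbal i)).
- move=> N phi C j [[top _ _] _ _ _] i e _ nv.
  (* The state vanishes at both ends of [e], so its restriction is itself the Dirichlet
     eigenfunction. *)
  have [dphi sol' [z0 zl]] := ends (phi i) e (top i).
  exists (on_edge (phi i) e), dphi; split => //.
  apply: contrapT => no; apply: nv => y yl; apply/eqP/negPn/negP => ny.
  by apply: no; exists y.
Qed.
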